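(* Let $M,C,G,F,h,x_*,\nu_1,\nu_2>0$, $\varepsilon$, the unforced vector field $f$ on $U_\varepsilon$, and the coordinates $(\tau,\xi)$ on $U_\varepsilon$ be as described in the context. Let the transverse linearization of $\dot x=f(x)$ along the orbit $x_*$ be the linear time-varying system $$\frac{d\xi}{d\tau}=A(\tau)\xi,\qquad A(\tau)\in\mathbb{R}^{3\times3},$$ with $A$ being $T_\tau$-periodic, and assume that its monodromy matrix is nondefective (diagonalizable over $\mathbb{C}$). Then this linear system admits two stable Floquet multipliers $\mu_1,\mu_2$ (counted with multiplicity), $|\mu_{1}|<1$ and $|\mu_2|<1$, and there exist two linearly independent Floquet solutions $\xi=e_1(\tau)$ and $\xi=e_2(\tau)$ associated with $\mu_1$ and $\mu_2$, respectively. These solutions span a two-dimensional stable invariant subspace $\mathcal{S}_\tau=\mathrm{span}\{e_1(\tau),e_2(\tau)\}$ of the linear system: solutions starting in $\mathcal{S}_{\tau_o}$ at $\tau=\tau_o$ remain in $\mathcal{S}_\tau$ and tend to $0$ as $\tau\to\infty$.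
   Context: Mechanical system. Consider $M(q)\ddot q+C(q,\dot q)\dot q+G(q)=F(q)u$ with $q\in\mathbb{R}^2$, $u\in\mathbb{R}$, where $M(q)\in\mathbb{R}^{2\times2}$ is symmetric positive definite, $C(q,\dot q)\in\mathbb{R}^{2\times2}$ is linear in $\dot q$, $G(q)\in\mathbb{R}^2$, $F(q)\in\mathbb{R}^{2\times1}$ is nonzero, and all functions are continuously differentiable. Write $x=(q,\dot q)\in\mathbb{R}^4$. Suppose the system admits (for a suitable input) a non-trivial $T$-periodic trajectory $x_*(t)=(q_*(t),\dot q_*(t))$ and a function $h\in C^2(\mathbb{R}^2,\mathbb{R})$ with $h(q_*(t))\equiv0$ and, for all $q$ in a neighborhood of $\{q_*(t)\}$, $\frac{\partial h}{\partial q}(q)\neq0$ and $\frac{\partial h}{\partial q}(q)M^{-1}(q)F(q)\neq0$. The symbol $x_*$ also denotes the orbit $\{x_*(t):t\in\mathbb{R}\}$, and $U_\varepsilon=\{x\in\mathbb{R}^4:\mathrm{dist}(x,x_* )<\varepsilon\}$, with $\varepsilon>0$ small enough that these non-degeneracy conditions hold for all $(q,\dot q)\in U_\varepsilon$. Unforced system. Denote $L_{\dot q}h=\frac{\partial h}{\partial q}\dot q$ and $L^2_{\dot q}h=\dot q^\top\frac{\partial^2h}{\partial q^2}\dot q$. For $\nu_1,\nu_2>0$, the vector field $f$ is the one obtained from the mechanical system with the feedback $$u=\frac{1}{\frac{\partial h}{\partial q}M^{-1}F}\Bigl(-\nu_1h-\nu_2L_{\dot q}h-L_{\dot q}^2h+\frac{\partial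 h}{\partial q}M^{-1}(C\dot q+G)\Bigr),$$ that is, $f(x)=\bigl(\dot q,\;M^{-1}(-C\dot q-G+Fu)\bigr)$. The trajectory $x_*(t)$ is a solution of $\dot x=f(x)$. Transverse coordinates. There are coordinates $\tau=\tau(x)\in\mathbb{R}$ and $\xi=\xi(x)\in\mathbb{R}^3$ defined in $U_\varepsilon$ such that: (i) $\xi(x_*(t))=0$ for all $t$; (ii) $\tau_*(t)=\tau(x_*(t))$ satisfies $\frac{d\tau_*}{dt}\ge\mathrm{const}>0$ on $[0,T)$ and extends continuously by $\tau_*(t+nT)=\tau_*(t)+nT_\tau$, $n\in\mathbb{Z}$, for some $T_\tau>0$ (so $\tau$ is understood modulo $T_\tau$); (iii) $x\mapsto(\tau,\xi)$ is a diffeomorphism on $U_\varepsilon$. In these coordinates the dynamics $\dot x=f(x)$ is represented within $U_\varepsilon$ as $\frac{d\xi}{d\tau}=A(\tau)\xi+r(\tau,\xi)$, where $A$ is a $T_\tau$-periodic (continuous) matrix function and $r$ collects the quadratic and higher-order terms in $\xi$; the transverse linearization is $\frac{d\xi}{d\tau}=A(\tau)\xi$. Floquet notions. The monodromy matrix is $X(T_\tau)$, where $\frac{dX}{d\tau}=A(\tau)X$, $X(0)=I$; its eigenvalues are the Floquet multipliers; a Floquet solution associated with a multiplier $\mu$ is a nonzero solution $e$ with $e(\tau+T_\tau)=\mu\,e(\tau)$. If $\mu_1,\mu_2$ form a complex conjugate pair, the solutions $e_1,e_2$ are complex conjugate and the span in $\mathbb{R}^3$ is understood as the real span of their real and imaginary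 parts. *)

(* Defs.v *)
From HB Require Import structures.
From mathcomp Require Import all_boot all_order all_algebra.
From mathcomp Require Import complex.
From mathcomp Require Import all_classical all_reals all_analysis.
Set Implicit Arguments.
Unset Strict Implicit.
Unset Printing Implicit Defensive.
Import Order.TTheory GRing.Theory Num.Theory numFieldNormedType.Exports.
Local Open Scope classical_set_scope.
Local Open Scope ring_scope.

(* Domains are finite dimensional here, so continuity of every directional
   derivative is continuity of the differential.  [U] is meant to be open. *)
Definition C1_on (R : realType) (E E' : normedModType R) (U : set E)
    (g : E -> E') : Prop :=
  forall x, U x ->
    differentiable g x /\ forall v, {for x, continuous (fun y => 'D_v g y)}.

Definition C1 (R : realType) (E E' : normedModType R) (g : E -> E') : Prop :=
  C1_on setT g.

Definition C2 (R : realType) (E E' : normedModType R) (g : E -> E') : Prop :=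
  C1 g /\ forall v, C1 (fun y => 'D_v g y).

Definition euclid_norm (R : realType) (n : nat) (v : 'cV[R]_n) : R :=
  Num.sqrt (\sum_i v i ord0 ^+ 2).

(* x = (q, qdot) in R^4 = R^2 x R^2 *)
Notation state R := ('cV[R]_2 * 'cV[R]_2)%type.

(* Euclidean distance in R^4; the library norm on products and matrices is the
   sup norm, hence the detour through [col_mx]. *)
Definition euclid_dist (R : realType) (x y : state R) : R :=
  euclid_norm (col_mx (x.1 - y.1) (x.2 - y.2)).

Definition dist_to (R : realType) (S : set (state R)) (x : state R) : R :=
  inf [set euclid_dist x y | y in S].

Definition tube (R : realType) (S : set (state R)) (eps : R) : set (state R) :=
  [set x | dist_to S x < eps].

Definition pos_def (R : realType) (n : nat) (B : 'M[R]_n) : Prop :=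
  forall v : 'cV[R]_n, v != 0 -> 0 < (v^T *m B *m v) ord0 ord0.

Definition mechanical_system (R : realType) (M : 'cV[R]_2 -> 'M[R]_2)
    (C : 'cV[R]_2 -> 'cV[R]_2 -> 'M[R]_2) (G F : 'cV[R]_2 -> 'cV[R]_2) : Prop :=
  [/\ forall q, (M q)^T = M q /\ pos_def (M q),
      forall q, linear (C q),
      forall q, F q != 0
    & [/\ C1 M, C1 (fun x : state R => C x.1 x.2), C1 G & C1 F] ].

Definition gradient (R : realType) (h : 'cV[R]_2 -> R) (q : 'cV[R]_2)
    : 'rV[R]_2 :=
  \row_j 'D_(delta_mx j ord0 : 'cV[R]_2) h q.

Definition hessian (R : realType) (h : 'cV[R]_2 -> R) (q : 'cV[R]_2)
    : 'M[R]_2 :=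
  \matrix_(i, j) 'D_(delta_mx j ord0 : 'cV[R]_2)
                   (fun p => 'D_(delta_mx i ord0 : 'cV[R]_2) h p) q.

Definition lie1 (R : realType) (h : 'cV[R]_2 -> R) (q dq : 'cV[R]_2) : R :=
  (gradient h q *m dq) ord0 ord0.

Definition lie2 (R : realType) (h : 'cV[R]_2 -> R) (q dq : 'cV[R]_2) : R :=
  (dq^T *m hessian h q *m dq) ord0 ord0.

Definition actuation_regular (R : realType) (M : 'cV[R]_2 -> 'M[R]_2)
    (F : 'cV[R]_2 -> 'cV[R]_2) (h : 'cV[R]_2 -> R) (q : 'cV[R]_2) : Prop :=
  gradient h q != 0 /\
  (gradient h q *m invmx (M q) *m F q) ord0 ord0 != 0.

Definition phase (R : realType) (qs : R -> 'cV[R]_2) (t : R) : state R :=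
  (qs t, derive1 qs t).

Definition mechanical_trajectory (R : realType) (M : 'cV[R]_2 -> 'M[R]_2)
    (C : 'cV[R]_2 -> 'cV[R]_2 -> 'M[R]_2) (G F : 'cV[R]_2 -> 'cV[R]_2)
    (u : R -> R) (qs : R -> 'cV[R]_2) : Prop :=
  forall t, [/\ derivable qs t 1, derivable (derive1 qs) t 1
    & M (qs t) *m derive1 (derive1 qs) t
      + C (qs t) (derive1 qs t) *m derive1 qs t + G (qs t)
      = u t *: F (qs t)].

Definition feedback (R : realType) (M : 'cV[R]_2 -> 'M[R]_2)
    (C : 'cV[R]_2 -> 'cV[R]_2 -> 'M[R]_2) (G F : 'cV[R]_2 -> 'cV[R]_2)
    (h : 'cV[R]_2 -> R) (nu1 nu2 : R) (x : state R) : R :=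
  let: (q, dq) := x in
  ((gradient h q *m invmx (M q) *m F q) ord0 ord0)^-1 *
  (- nu1 * h q - nu2 * lie1 h q dq - lie2 h q dq
   + (gradient h q *m invmx (M q) *m (C q dq *m dq + G q)) ord0 ord0).

Definition closed_loop (R : realType) (M : 'cV[R]_2 -> 'M[R]_2)
    (C : 'cV[R]_2 -> 'cV[R]_2 -> 'M[R]_2) (G F : 'cV[R]_2 -> 'cV[R]_2)
    (h : 'cV[R]_2 -> R) (nu1 nu2 : R) (x : state R) : state R :=
  let: (q, dq) := x in
  (dq, invmx (M q) *m (- (C q dq *m dq) - G q
                       + feedback M C G F h nu1 nu2 x *: F q)).

Definition eqmod (R : realType) (P a b : R) : Prop :=
  exists k : int, b = a + P *~ k.

(* [tau : state R -> R] stands for a map to the circle R / P Z, so it may jump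
   by multiples of P; a branch at [x] is a local C^1 lift of that map. *)
Definition branch (R : realType) (P : R) (tau : state R -> R) (x : state R)
    (t : state R -> R) : Prop :=
  exists W : set (state R),
    [/\ open W, W x, C1_on W t & forall y, W y -> eqmod P (tau y) (t y)].

(* [x |-> (tau x mod P, xi x)] is a C^1 diffeomorphism of [U] onto an open
   subset of (R / P Z) x R^3: that subset is given by its P-periodic preimage
   [V] in R x R^3 and the inverse diffeomorphism by its P-periodic lift [Phi]. *)
Definition diffeo_mod (R : realType) (P : R) (U : set (state R))
    (tau : state R -> R) (xi : state R -> 'cV[R]_3) : Prop :=
  [/\ C1_on U xi,
      forall x, U x -> exists t, branch P tau x t
    & exists (V : set (R * 'cV[R]_3)) (Phi : R * 'cV[R]_3 -> state R),
        [/\ open V, C1_on V Phi,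
            forall x, U x -> V (tau x, xi x) /\ Phi (tau x, xi x) = x,
            forall s z, V (s, z) ->
              [/\ U (Phi (s, z)), eqmod P (tau (Phi (s, z))) s
                & xi (Phi (s, z)) = z]
          & forall s z (n : int), V (s, z) ->
              V (s + P *~ n, z) /\ Phi (s + P *~ n, z) = Phi (s, z)] ].

Definition transverse_coordinates (R : realType) (T P : R)
    (xs : R -> state R) (U : set (state R))
    (tau : state R -> R) (xi : state R -> 'cV[R]_3) (taus : R -> R) : Prop :=
  [/\ forall t, xi (xs t) = 0,
      [/\ forall t, 0 <= t < T -> taus t = tau (xs t),
          exists2 c : R, 0 < c &
            forall t, 0 <= t < T -> derivable taus t 1 /\ c <= derive1 taus t,
          continuous taus
        & forall t (n : int), taus (t + T *~ n) = taus t + P *~ n]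
    & diffeo_mod P U tau xi].

(* d xi / d tau is the quotient of the derivatives of xi and tau along f. *)
Definition transverse_dynamics (R : realType) (P : R) (U : set (state R))
    (f : state R -> state R) (tau : state R -> R) (xi : state R -> 'cV[R]_3)
    (A : R -> 'M[R]_3) (r : R -> 'cV[R]_3 -> 'cV[R]_3) : Prop :=
  forall x, U x -> forall t, branch P tau x t ->
    'D_(f x) t x != 0 /\
    ('D_(f x) t x)^-1 *: 'D_(f x) xi x
      = A (tau x) *m xi x + r (tau x) (xi x).

(* r = O(|xi|^2) uniformly in tau on the range of the coordinates *)
Definition higher_order (R : realType) (U : set (state R))
    (tau : state R -> R) (xi : state R -> 'cV[R]_3)
    (r : R -> 'cV[R]_3 -> 'cV[R]_3) : Prop :=
  exists K delta : R, 0 < delta /\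
    forall x, U x -> euclid_norm (xi x) < delta ->
      euclid_norm (r (tau x) (xi x)) <= K * euclid_norm (xi x) ^+ 2.

Definition solution_on (R : realType) (D : set R) (A : R -> 'M[R]_3)
    (z : R -> 'cV[R]_3) : Prop :=
  forall s : R, D s -> is_derive s 1 z (A s *m z s).

Definition principal_fundamental (R : realType) (A X : R -> 'M[R]_3) : Prop :=
  X 0 = 1%:M /\ forall s : R, is_derive s 1 X (A s *m X s).

Definition complexify (R : realType) (m n : nat) (B : 'M[R]_(m, n))
    : 'M[R[i]]_(m, n) := map_mx (real_complex R) B.

Definition re_part (R : realType) (e : R -> 'cV[R[i]]_3) (s : R) : 'cV[R]_3 :=
  map_mx (@complex.Re R) (e s).

Definition im_part (R : realType) (e : R -> 'cV[R[i]]_3) (s : R) : 'cV[R]_3 :=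
  map_mx (@complex.Im R) (e s).

(* The derivative of a C^3-valued function of a real variable is taken on real
   and imaginary parts; as A is real, each part solves the system. *)
Definition floquet_solution (R : realType) (A : R -> 'M[R]_3) (P : R)
    (mu : R[i]) (e : R -> 'cV[R[i]]_3) : Prop :=
  [/\ solution_on setT A (re_part e) /\ solution_on setT A (im_part e),
      exists s, e s != 0
    & forall s, e (s + P) = mu *: e s].

Definition lin_indep (R : realType) (e1 e2 : R -> 'cV[R[i]]_3) : Prop :=
  forall a b : R[i], (forall s, a *: e1 s + b *: e2 s = 0) -> a = 0 /\ b = 0.

Definition real_floquet_pair (R : realType) (mu1 mu2 : R[i])
    (e1 e2 : R -> 'cV[R[i]]_3) : Prop :=
  [/\ complex.Im mu1 = 0, complex.Im mu2 = 0
    & forall s, im_part e1 s = 0 /\ im_part e2 s = 0].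

Definition conj_floquet_pair (R : realType) (mu1 mu2 : R[i])
    (e1 e2 : R -> 'cV[R[i]]_3) : Prop :=
  [/\ complex.Im mu1 != 0, mu2 = conjc mu1
    & forall s, e2 s = map_mx (@conjc R) (e1 s)].

(* For a real pair this is the real span of e1(s), e2(s); for a conjugate pair,
   that of Re e1(s), Im e1(s). *)
Definition floquet_span (R : realType) (e1 e2 : R -> 'cV[R[i]]_3) (s : R)
    : {vspace 'cV[R]_3} :=
  <<[:: re_part e1 s; im_part e1 s; re_part e2 s; im_part e2 s]>>%VS.

(* Main.v *)
Require Import Defs.
From HB Require Import structures.
From mathcomp Require Import all_boot all_order all_algebra.
From mathcomp Require Import complex.
From mathcomp Require Import all_classical all_reals all_analysis.
From mathcomp Require Import ring lra.
Set Implicit Arguments.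
Unset Strict Implicit.
Unset Printing Implicit Defensive.
Import Order.TTheory GRing.Theory Num.Theory numFieldNormedType.Exports.
Local Open Scope classical_set_scope.
Local Open Scope ring_scope.

(* Along the closed loop the output y = h(q) satisfies y'' + nu2 y' + nu1 y = 0,
   so the pair H = (h, L_qdot h) obeys a Hurwitz linear equation with matrix N.
   In transverse coordinates H vanishes on the orbit and is a submersion, hence
   its transverse differential W(tau) has rank 2, and Y(t) = W(tau(t)) X(tau(t))
   satisfies Y' = N Y and Y(T) = Y(0) X(T_tau).  If X(T_tau) v = mu v and
   Y(0) v <> 0, then (Y v)(T) = mu (Y v)(0), and the energy
   nu1 |y|^2 + |y'|^2 of the damped oscillator forces |mu| < 1.  As Y(0) has
   rank 2, at least two vectors of an eigenbasis are not killed by Y(0).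

   H is only C^1 in the coordinates, so W need not be differentiable; Y' = N Y
   is obtained by differentiating H along tau |-> delta xi(tau), for xi a
   solution of the linear system, and letting delta tend to 0 (lemma
   [is_derive_interchange]). *)

(** * Linear differential equations *)

(** The energy of an output decays at rate 2 nu2 |y'|^2, which is not definite: it vanishes wherever
    y' does. Strictness comes from an invariance argument: without loss over one period the energy
    is constant, so y' = 0 on an interval, and the equation then gives y = 0.

    Derivatives are available over the reals only, so a complex eigenvector v = a + i b is carried
    as the pair (a, b). Adding the energies of Y a and Y b makes the rotation by arg mu drop out and
    leaves the factor |mu|^2. Two eigenvectors not killed by Y(0) need not be closed under
    conjugation, whereas a real invariant plane is wanted; hence a non-real one is paired with its
    own conjugate, and the second one is used only if both multipliers are real.

    The coordinate tau is a map to a circle and may jump. Differentiation therefore uses local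
    branches of tau and, above all, the inverse chart [Phi], which is periodic and smooth; the
    outputs are studied as functions on the chart. *)

Section Matrices.
Variables (R : realType) (m n : nat).

Lemma cvg_mxP (T : Type) (F : set_system T) {FF : Filter F}
    (B : T -> 'M[R]_(m, n)) (L : 'M[R]_(m, n)) :
  (forall i j, B x i j @[x --> F] --> L i j) -> B x @[x --> F] --> L.
Proof.
move=> BL S [P LP sPS]; apply: (filterS sPS) => /=.
apply: filter_forall => i; apply: filter_forall => j.
exact: BL (LP i j).
Qed.

Lemma cvg_coord (T : Type) (F : set_system T) {FF : Filter F}
    (B : T -> 'M[R]_(m, n)) (L : 'M[R]_(m, n)) i j :
  B x @[x --> F] --> L -> B x i j @[x --> F] --> L i j.
Proof.
exact: (@continuous_cvg _ _ _ F FF B (fun N : 'M[R]_(m, n) => N i j) L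
  (@coord_continuous _ _ _ i j L)).
Qed.

Lemma le_coord_norm (B : 'M[R]_(m, n)) i j : `|B i j| <= `|B|.
Proof.
rewrite [leRHS]/Num.Def.normr/= mx_normrE.
exact: (le_bigmax _ (fun ij : 'I_m * 'I_n => `|B ij.1 ij.2|) (i, j)).
Qed.

Lemma is_derive_coord (V : normedModType R) (B : V -> 'M[R]_(m, n)) x v dB i j :
  is_derive x v B dB -> is_derive x v (fun y => B y i j) (dB i j).
Proof.
move=> [dBx dBE]; apply: DeriveDef; first exact: (derivable_mxP _ _ _).1.
by rewrite -dBE derive_mx// mxE.
Qed.

Lemma is_derive_mx (V : normedModType R) (B : V -> 'M[R]_(m, n)) x v
    (dB : 'M[R]_(m, n)) :
  (forall i j, is_derive x v (fun y => B y i j) (dB i j)) ->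
  is_derive x v B dB.
Proof.
move=> dBij; have dBx : derivable B x v.
  by apply/derivable_mxP => i j; case: (dBij i j).
apply: DeriveDef => //; rewrite derive_mx//; apply/matrixP => i j.
by rewrite mxE; case: (dBij i j).
Qed.

End Matrices.

Lemma cvg_sumr (R : realType) (V : normedModType R) (T : Type)
    (F : set_system T) {FF : Filter F} n (f : 'I_n -> T -> V) (l : 'I_n -> V) :
  (forall i, f i x @[x --> F] --> l i) ->
  \sum_i f i x @[x --> F] --> \sum_i l i.
Proof.
move=> fl; have -> : (fun x => \sum_i f i x) = \sum_i f i.
  by apply/funext => x; rewrite fct_sumE.
elim/big_ind2 : _ => //; first exact: cvg_cst.
by move=> ? ? ? ? ? ?; exact: cvgD.
Qed.

Section LinearODE.
Variable R : realType.

(** [E s * expR (- K * s)] is nonincreasing, so it cannot rise above its initial value 0. *)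
Lemma gronwall_eq0 (E dE : R -> R) (K a b : R) : a <= b ->
  (forall s, s \in `[a, b] -> is_derive s 1 E (dE s)) ->
  (forall s, s \in `[a, b] -> dE s <= K * E s) ->
  (forall s, 0 <= E s) -> E a = 0 -> E b = 0.
Proof.
move=> ab dEs dEK E0 Ea; apply/eqP; rewrite eq_le E0 andbT.
pose g s := E s * expR (- K * s).
have dg s : s \in `[a, b] ->
    is_derive s 1 g (E s * (expR (- K * s) * (- K)) + expR (- K * s) * dE s).
  move=> sab; have ? := dEs s sab.
  have ? : is_derive s 1 (fun s => expR (- K * s)) (expR (- K * s) * - K).
    have -> : (fun s => expR (- K * s)) = expR \o ( *%R (- K)) by [].
    apply: (@is_derive1_comp _ expR ( *%R (- K))).
    by rewrite -[X in is_derive _ _ _ X]mulr1; exact: is_deriveZ.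
  exact: is_deriveM.
have ba : g b <= g a.
  apply: (@ler0_derive1_nincr _ g a b) => //.
  - move=> s /subset_itv_oo_cc sab; case: (dg s sab) => //.
  - move=> s /subset_itv_oo_cc sab; rewrite derive1E; case: (dg s sab) => _ ->.
    have := dEK s sab; have := expR_gt0 (- K * s); nra.
  - by apply: derivable_within_continuous => s sab; case: (dg s sab).
by move: ba; rewrite /g Ea mul0r pmulr_lle0// expR_gt0.
Qed.

(** Gronwall's inequality for the squared Euclidean norm, forwards and, after reversing time,
    backwards. Both directions are needed, since solutions are compared with their value at 0 on
    either side of 0. *)
Lemma linear_ode_eq0 n (A : R -> 'M[R]_n) (z : R -> 'cV[R]_n) (a b : R) :
  continuous A -> a <= b ->
  (forall s, s \in `[a, b] -> is_derive s 1 z (A s *m z s)) ->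
  z a = 0 <-> z b = 0.
Proof.
move=> cA ab dz.
have [c _ cmax] : exists2 c, c \in `[a, b] &
    forall t, t \in `[a, b] -> `|A t| <= `|A c|.
  apply: (@EVT_max _ (fun s => `|A s|)) => //.
  apply: continuous_subspaceT => s; apply: continuous_comp; first exact: cA.
  exact: norm_continuous.
set B := `|A c| in cmax.
pose E s := \sum_i z s i 0 ^+ 2.
pose dE s := \sum_i 2 * (z s i 0 * (A s *m z s) i 0).
have E0 s : 0 <= E s by apply: sumr_ge0 => i _; exact: sqr_ge0.
have Eeq0 s : E s = 0 <-> z s = 0.
  split=> [Es|zs]; last first.
    by apply: big1 => i _; rewrite zs mxE expr0n.
  apply/matrixP => i j; rewrite (ord1 j) mxE; apply/eqP; rewrite -sqrf_eq0.
  by move/psumr_eq0P : Es => -> // k _; exact: sqr_ge0.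
have dEs s : s \in `[a, b] -> is_derive s 1 E (dE s).
  move=> sab.
  have -> : E = \sum_i (fun s => z s i 0 ^+ 2).
    by apply/funext => t; rewrite fct_sumE.
  apply: is_derive_sum => i.
  have dzi := is_derive_coord i ord0 (dz s sab).
  have -> : (fun t => z t i 0 ^+ 2) = (fun t => z t i 0) ^+ 2.
    by apply/funext => t.
  apply: is_derive_eq; rewrite expr1; exact/esym/mulrA.
have dEK s : s \in `[a, b] -> `|dE s| <= (B *+ n *+ 2) * E s.
  move=> sab.
  (* Once 2 n B E is spread over all pairs (i, j), the bound follows term by term from 2 |z_i z_j|
     <= z_i^2 + z_j^2. *)
  have -> : B *+ n *+ 2 * E s =
      \sum_(i < n) \sum_(j < n) B * (z s i 0 ^+ 2 + z s j 0 ^+ 2).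
    under eq_bigr do rewrite -mulr_sumr big_split/= sumr_const card_ord.
    rewrite -mulr_sumr big_split/= sumr_const card_ord -/(E s) sumrMnl -/(E s).
    by rewrite mulrDr -mulr2n !mulrnAr !mulrnAl.
  apply: le_trans (ler_norm_sum _ _ _) _; apply: ler_sum => i _.
  rewrite mxE !mulr_sumr; apply: le_trans (ler_norm_sum _ _ _) _.
  apply: ler_sum => j _.
  have Aij : `|A s i j| <= B by apply: le_trans (cmax s sab); exact: le_coord_norm.
  have B0 : 0 <= B by exact: normr_ge0.
  have -> : 2 * (z s i 0 * (A s i j * z s j 0)) =
      A s i j * (2 * (z s i 0 * z s j 0)) by ring.
  rewrite normrM; apply: ler_pM => //.
  rewrite ler_norml; have := sqr_ge0 (z s i 0 - z s j 0).
  have := sqr_ge0 (z s i 0 + z s j 0); rewrite !expr2 => ? ?.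
  by apply/andP; split; nra.
rewrite -!Eeq0; split => [Ea|Eb].
  apply: (@gronwall_eq0 E dE (B *+ n *+ 2) a b) => // s sab.
  by apply: le_trans (dEK s sab); exact: ler_norm.
have nab s : s \in `[- b, - a] -> - s \in `[a, b].
  by rewrite !in_itv/= => /andP[? ?]; rewrite lerNr lerNl; apply/andP.
(* Time reversal. The bound on [dE] was proved for its absolute value, so it survives the change of
   sign. *)
pose E' s := E (- s).
suff : E' (- a) = 0 by rewrite /E' opprK.
have gr := @gronwall_eq0 E' (fun s => - dE (- s)) (B *+ n *+ 2) (- b) (- a).
apply gr.
- by rewrite lerN2.
- move=> s sab; have dEs' := dEs (- s) (nab s sab).
  rewrite -mulrN1; apply: (@is_derive1_comp _ E -%R) => //.
- move=> s sab; apply: le_trans (dEK (- s) (nab s sab)).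
  by rewrite -normrN; exact: ler_norm.
- by move=> s; exact: E0.
- by rewrite /E' opprK.
Qed.

End LinearODE.

(** * Fundamental matrix and monodromy *)

Section FundamentalMatrix.
Variables (R : realType) (A X : R -> 'M[R]_3) (P : R).
Hypotheses (cA : continuous A) (pA : periodic A P).
Hypothesis XA : principal_fundamental A X.

Let X0 : X 0 = 1%:M. Proof. by case: XA. Qed.
Let dX (s : R) : is_derive s 1 X (A s *m X s). Proof. by case: XA. Qed.

Lemma is_derive_mulmxr (B : R -> 'M[R]_3) n (v : 'M[R]_(3, n)) (s : R) dB :
  is_derive s 1 B dB -> is_derive s 1 (fun s => B s *m v) (dB *m v).
Proof.
move=> dBs; apply: is_derive_mx => i j.
have -> : (dB *m v) i j = \sum_k v k j *: dB i k.
  by rewrite mxE; apply: eq_bigr => k _; rewrite mulrC.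
have -> : (fun y => (B y *m v) i j) = \sum_k (v k j *: (fun y => B y i k)).
  apply/funext => t; rewrite fct_sumE mxE; apply: eq_bigr => k _.
  by rewrite mulrC.
apply: is_derive_sum => k; apply: is_deriveZ.
exact: is_derive_coord.
Qed.

Lemma fundamental_solution (v : 'cV[R]_3) (s : R) :
  is_derive s 1 (fun s => X s *m v) (A s *m (X s *m v)).
Proof. by rewrite mulmxA; exact: is_derive_mulmxr. Qed.

Lemma solution_unique (z1 z2 : R -> 'cV[R]_3) (a b : R) : a <= b ->
  (forall s, s \in `[a, b] -> is_derive s 1 z1 (A s *m z1 s)) ->
  (forall s, s \in `[a, b] -> is_derive s 1 z2 (A s *m z2 s)) ->
  z1 a = z2 a <-> z1 b = z2 b.
Proof.
move=> ab dz1 dz2.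
have [|h1 h2] := @linear_ode_eq0 R 3 A (z1 - z2) a b cA ab.
  move=> s sab; have ? := dz1 s sab; have ? := dz2 s sab.
  by rewrite [(z1 - z2) s]/(z1 s - z2 s) mulmxBr; exact: is_deriveB.
split=> [z12|z12].
  by apply/eqP; rewrite -subr_eq0; apply/eqP/h1/eqP; rewrite subr_eq0 z12.
by apply/eqP; rewrite -subr_eq0; apply/eqP/h2/eqP; rewrite subr_eq0 z12.
Qed.

(** Serves solutions known on a half-line only, as in the statement on the stable subspace;
    [solution_global] is its analogue on the whole line. *)
Lemma solution_forward (z : R -> 'cV[R]_3) s0 u :
  solution_on [set s | s0 <= s] A z -> z s0 = X s0 *m u ->
  forall s, s0 <= s -> z s = X s *m u.
Proof.
move=> dz zs0 s s0s.
have dz' t : t \in `[s0, s] -> is_derive t 1 z (A t *m z t).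
  by rewrite in_itv/= => /andP[s0t _]; exact: dz.
have dX' (t : R) : t \in `[s0, s] ->
    is_derive t 1 (fun s => X s *m u) (A t *m (X t *m u)).
  by move=> _; exact: fundamental_solution.
exact: (solution_unique s0s dz' dX').1 zs0.
Qed.

Lemma solution_global (z : R -> 'cV[R]_3) u :
  solution_on setT A z -> z 0 = u -> forall s, z s = X s *m u.
Proof.
move=> dz z0 s.
have Xu0 : z 0 = X 0 *m u by rewrite X0 mul1mx.
have dz' (a b t : R) : t \in `[a, b] -> is_derive t 1 z (A t *m z t).
  by move=> _; exact: dz.
have dX' (a b t : R) : t \in `[a, b] ->
    is_derive t 1 (fun s => X s *m u) (A t *m (X t *m u)).
  by move=> _; exact: fundamental_solution.
have [s0|/ltW s0] := leP 0 s.
  exact: (solution_unique s0 (dz' _ _) (dX' _ _)).1.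
exact: (solution_unique s0 (dz' _ _) (dX' _ _)).2.
Qed.

(** A vector killed by X(s) yields a solution that vanishes at s, hence also at 0, where X is the
    identity. *)
Lemma fundamental_unit s : X s \in unitmx.
Proof.
rewrite -unitmx_tr -row_free_unit -kermx_eq0; apply/rowV0P => v /sub_kermxP.
move=> /(congr1 trmx); rewrite trmx_mul trmxK trmx0 => Xv0.
suff : v^T = 0 by move/(congr1 trmx); rewrite trmxK trmx0.
have d0 (a b t : R) : t \in `[a, b] ->
    is_derive t 1 (fun=> 0 : 'cV[R]_3) (A t *m 0).
  by move=> _; rewrite mulmx0; exact: is_derive_cst.
have dXv (a b t : R) : t \in `[a, b] ->
    is_derive t 1 (fun s => X s *m v^T) (A t *m (X t *m v^T)).
  by move=> _; exact: fundamental_solution.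
rewrite -[v^T]mul1mx -X0; have [s0|/ltW s0] := leP 0 s.
  exact: (solution_unique s0 (dXv _ _) (d0 _ _)).2 Xv0.
exact: (solution_unique s0 (dXv _ _) (d0 _ _)).1 Xv0.
Qed.

(** As A is P-periodic, translating a column of X by P gives another solution, which is determined
    by its value at 0, a column of X(P). *)
Lemma fundamental_monodromy s : X (s + P) = X s *m X P.
Proof.
apply/matrixP => i j.
suff : X (s + P) *m delta_mx j 0 = X s *m (X P *m (delta_mx j 0 : 'cV_3)).
  by rewrite mulmxA -!colE => /matrixP/(_ i 0); rewrite !mxE.
move: s; apply: solution_global; last by rewrite add0r.
move=> s _; rewrite -[A s](pA s).
have ds := fundamental_solution (delta_mx j 0) (s + P).
apply: is_derive_mx => k l.
have -> : (fun y => (X (y + P) *m (delta_mx j 0 : 'cV_3)) k l)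
  = (fun y => (X y *m (delta_mx j 0 : 'cV_3)) k l) \o shift P by [].
rewrite -[X in is_derive _ _ _ X]mulr1.
apply: (@is_derive1_comp _ _ (shift P)); first exact: is_derive_coord.
exact: is_derive_shift.
Qed.

End FundamentalMatrix.

(** After n periods E is at most m^n times its maximum over one period. *)
Lemma cvg_contracting_period (R : realType) (E : R -> R) (P m : R) :
  0 < P -> 0 <= m < 1 -> continuous E -> (forall s, 0 <= E s) ->
  (forall s, E (s + P) = m * E s) -> E s @[s --> +oo] --> (0 : R).
Proof.
move=> P0 /andP[m0 m1] cE E0 EP.
have [c _ cmax] : exists2 c, c \in `[0, P] & forall t, t \in `[0, P] -> E t <= E c.
  by apply: EVT_max; [exact: ltW|exact: continuous_subspaceT].
have En n s : E (s + P *+ n) = m ^+ n * E s.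
  elim: n => [|n ih]; first by rewrite mulr0n addr0 mul1r.
  by rewrite mulrSr addrA EP ih exprS mulrA.
have bnd n s : P *+ n <= s -> E s <= m ^+ n * E c.
  move=> ns.
  (* The number of whole periods in [s]; removing them brings [s] back to [0, P]. *)
  pose k := Num.truncn (s / P).
  have s0 : 0 <= s by apply: le_trans ns; rewrite mulrn_wge0// ltW.
  have /andP[ks sk] : P *+ k <= s < P *+ k.+1.
    have := truncn_itv (divr_ge0 s0 (ltW P0)).
    by rewrite -/k ler_pdivlMr// ltr_pdivrMr// !mulr_natl.
  have nk : (n <= k)%N.
    by have := le_lt_trans ns sk; rewrite ltr_pMn2l.
  rewrite -[s](subrK (P *+ k)) En; apply: ler_pM => //.
  - exact: exprn_ge0.
  - by rewrite ler_wiXn2l// ltW.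
  - apply: cmax; rewrite in_itv/= subr_ge0 ks/= lerBlDl -mulrSr.
    exact: ltW.
apply/cvgrPdist_lt => e e0.
have mc : m ^+ n * E c @[n --> \oo] --> (0 : R).
  rewrite -[X in _ --> X](mul0r (E c)); apply: cvgM; last exact: cvg_cst.
  by apply: cvg_expr; rewrite ger0_norm.
move/cvgrPdist_lt : mc => /(_ e e0)[N _ Ne].
exists (P *+ N); split; first exact: num_real.
move=> s Ns; rewrite sub0r normrN ger0_norm//.
apply: le_lt_trans (bnd N s (ltW Ns)) _.
have := Ne N (leqnn _); rewrite /= sub0r normrN ger0_norm//.
by rewrite mulr_ge0// exprn_ge0.
Qed.

(** * Complex vectors and eigenpairs *)

Section ComplexVectors.
Variables (R : realType) (n : nat).

Definition cplx (a b : 'cV[R]_n) : 'cV[R[i]]_n :=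
  \col_k Complex (a k 0) (b k 0).

Lemma cplx_ReIm (v : 'cV[R[i]]_n) :
  cplx (map_mx (@complex.Re R) v) (map_mx (@complex.Im R) v) = v.
Proof.
by apply/matrixP => k j; rewrite (ord1 j) !mxE; case: (v k 0).
Qed.

Lemma map_Re_cplx a b : map_mx (@complex.Re R) (cplx a b) = a.
Proof. by apply/matrixP => k j; rewrite (ord1 j) !mxE. Qed.

Lemma map_Im_cplx a b : map_mx (@complex.Im R) (cplx a b) = b.
Proof. by apply/matrixP => k j; rewrite (ord1 j) !mxE. Qed.

Lemma scale_cplx (mu : R[i]) a b : mu *: cplx a b =
  cplx (complex.Re mu *: a - complex.Im mu *: b)
       (complex.Im mu *: a + complex.Re mu *: b).
Proof.
apply/matrixP => k j; rewrite !mxE; case: mu => x y /=.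
by apply/eqP; rewrite eq_complex/= eqxx addrC eqxx.
Qed.

Lemma addr_cplx a b a' b' : cplx a b + cplx a' b' = cplx (a + a') (b + b').
Proof. by apply/matrixP => k j; rewrite !mxE. Qed.

Lemma cplx_eq0 a b : cplx a b = 0 <-> a = 0 /\ b = 0.
Proof.
split=> [ab0|[-> ->]]; last by apply/matrixP => k j; rewrite !mxE.
split; first by rewrite -(map_Re_cplx a b) ab0; apply/matrixP => k j; rewrite !mxE.
by rewrite -(map_Im_cplx a b) ab0; apply/matrixP => k j; rewrite !mxE.
Qed.

Lemma conj_cplx a b : map_mx (@conjc R) (cplx a b) = cplx a (- b).
Proof. by apply/matrixP => k j; rewrite !mxE. Qed.

Lemma mul_cplx m (B : 'M[R]_(m, n)) a b :
  complexify B *m cplx a b = \col_k Complex ((B *m a) k 0) ((B *m b) k 0).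
Proof.
apply/matrixP => k j; rewrite !mxE.
elim/big_ind3 : _ => //; first by move=> ? ? ? ? ? ? -> ->.
move=> l _; rewrite !mxE; apply/eqP; rewrite eq_complex/=.
by rewrite !mul0r subr0 addr0 !eqxx.
Qed.

End ComplexVectors.

Section StablePair.
Variable R : realType.

(** Real and imaginary parts of B (a + i b) = mu (a + i b). The case a = b = 0 is not excluded;
    nonvanishing is stated separately where it matters. *)
Definition eigenpair n (B : 'M[R]_n) (mu : R[i]) (a b : 'cV[R]_n) : Prop :=
  B *m a = complex.Re mu *: a - complex.Im mu *: b /\
  B *m b = complex.Im mu *: a + complex.Re mu *: b.

Definition independent n (a b : 'cV[R]_n) : Prop :=
  forall x y : R, x *: a + y *: b = 0 -> x = 0 /\ y = 0.

Lemma eigenpairP n (B : 'M[R]_n) mu a b :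
  complexify B *m cplx a b = mu *: cplx a b <-> eigenpair B mu a b.
Proof.
rewrite mul_cplx -/(cplx _ _) scale_cplx; split=> [E|[-> ->//]].
split.
  by have := congr1 (map_mx (@complex.Re R)) E; rewrite !map_Re_cplx.
by have := congr1 (map_mx (@complex.Im R)) E; rewrite !map_Im_cplx.
Qed.

(** Applying B to x a + y b = 0 gives, as Im mu is nonzero, the second relation y a - x b = 0. The
    two relations have determinant -(x^2 + y^2), so either x = y = 0 or a = b = 0. *)
Lemma nonreal_eigenpair_independent n (B : 'M[R]_n) mu a b :
  eigenpair B mu a b -> complex.Im mu != 0 -> a <> 0 \/ b <> 0 ->
  independent a b.
Proof.
move=> [Ba Bb] mu0 ab0 x y xy0.
have yx0 : y *: a - x *: b = 0.
  have := congr1 (mulmx B) xy0; rewrite mulmx0 mulmxDr -!scalemxAr Ba Bb.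
  set p := complex.Re mu; set q := complex.Im mu.
  have -> : x *: (p *: a - q *: b) + y *: (q *: a + p *: b) =
      p *: (x *: a + y *: b) + q *: (y *: a - x *: b).
    by apply/matrixP => k j; rewrite !mxE; ring.
  by rewrite xy0 scaler0 add0r => /eqP; rewrite scaler_eq0 (negPf mu0) => /eqP.
have a0 : (x ^+ 2 + y ^+ 2) *: a = 0.
  have -> : (x ^+ 2 + y ^+ 2) *: a =
      x *: (x *: a + y *: b) + y *: (y *: a - x *: b).
    by apply/matrixP => k j; rewrite !mxE; ring.
  by rewrite xy0 yx0 !scaler0 addr0.
have b0 : (x ^+ 2 + y ^+ 2) *: b = 0.
  have -> : (x ^+ 2 + y ^+ 2) *: b =
      y *: (x *: a + y *: b) - x *: (y *: a - x *: b).
    by apply/matrixP => k j; rewrite !mxE; ring.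
  by rewrite xy0 yx0 !scaler0 subr0.
have : x ^+ 2 + y ^+ 2 = 0.
  apply/eqP; apply/negPn/negP => xy.
  move/eqP : a0; move/eqP : b0; rewrite !scaler_eq0 !(negPf xy)/=.
  by move=> /eqP b0 /eqP a0; case: ab0.
move/eqP; rewrite paddr_eq0 ?sqr_ge0// !sqrf_eq0 => /andP[/eqP -> /eqP ->].
by [].
Qed.

(** Cramer's rule on the coordinates k and l. *)
Lemma minor_independent n (a b : 'cV[R]_n) k l :
  a k 0 * b l 0 - a l 0 * b k 0 != 0 -> independent a b.
Proof.
move=> ab x y /matrixP xy0.
have := xy0 k 0; have := xy0 l 0; rewrite !mxE => El Ek.
have x0 : x * (a k 0 * b l 0 - a l 0 * b k 0) = 0.
  have -> : x * (a k 0 * b l 0 - a l 0 * b k 0) =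
    (x * a k 0 + y * b k 0) * b l 0 - (x * a l 0 + y * b l 0) * b k 0 by ring.
  by rewrite Ek El !mul0r subrr.
have y0 : y * (a k 0 * b l 0 - a l 0 * b k 0) = 0.
  have -> : y * (a k 0 * b l 0 - a l 0 * b k 0) =
    (x * a l 0 + y * b l 0) * a k 0 - (x * a k 0 + y * b k 0) * a l 0 by ring.
  by rewrite Ek El !mul0r subrr.
by split; [move/eqP : x0|move/eqP : y0]; rewrite mulf_eq0 (negPf ab) orbF => /eqP.
Qed.

(** If all minors of the columns i and j vanish, then for each k the matrix S kills the vector with
    entry S k i at j and -S k j at i. Invertibility forces S k i = 0 for every k, so column i would
    be zero. *)
Lemma nonzero_minor (K : fieldType) n (S : 'M[K]_n) i j :
  S \in unitmx -> i != j ->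
  exists k l, S k i * S l j - S l i * S k j != 0.
Proof.
move=> Su ij; apply: contrapT => noex.
have minor0 k l : S k i * S l j = S l i * S k j.
  apply/eqP; rewrite -subr_eq0; apply/negPn/negP => kl.
  by apply: noex; exists k, l.
have col0 (v : 'cV_n) : S *m v = 0 -> v = 0.
  by move=> Sv; rewrite -(mulKmx Su v) Sv mulmx0.
have Ski k : S k i = 0.
  have /col0/matrixP/(_ j 0) :
      S *m (S k i *: delta_mx j 0 - S k j *: delta_mx i 0 : 'cV_n) = 0.
    apply/matrixP => l z; rewrite mulmxBr -!scalemxAr -!colE !mxE minor0.
    by rewrite mulrC subrr.
  by rewrite !mxE !eqxx/= mulr1 eq_sym (negPf ij) mulr0 subr0.
have : delta_mx i 0 = 0 :> 'cV[K]_n.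
  by apply: col0; rewrite -colE; apply/matrixP => l z; rewrite !mxE Ski.
by move/matrixP/(_ i 0); rewrite !mxE !eqxx => /eqP; rewrite oner_eq0.
Qed.

(** With a single nonzero column, W factors through a space of dimension one. *)
Lemma two_nonzero_columns (K : fieldType) m n (W : 'M[K]_(m, n)) :
  (1 < \rank W)%N -> exists i j, [/\ i != j, col i W != 0 & col j W != 0].
Proof.
move=> rW; apply: contrapT => noex.
have [i Wi] : exists i, col i W != 0.
  apply: contrapT => all0; move: rW; suff -> : W = 0 by rewrite mxrank0.
  apply/matrixP => k l; rewrite mxE; apply/eqP/negPn/negP => Wkl.
  apply: all0; exists l; apply: contraNneq Wkl => /matrixP/(_ k 0).
  by rewrite !mxE => ->.
have WE : W = col i W *m (delta_mx 0 i : 'rV_n).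
  apply/matrixP => k l; rewrite !mxE big_ord1 !mxE eqxx/= eq_sym.
  have [->|li] := eqVneq l i; first by rewrite mulr1.
  rewrite mulr0; apply/eqP/negPn/negP => Wkl; apply: noex; exists i, l.
  split => //; first by rewrite eq_sym.
  by apply: contraNneq Wkl => /matrixP/(_ k 0); rewrite !mxE => ->.
have : (\rank W <= 1)%N.
  by rewrite WE; apply: leq_trans (mxrankM_maxl _ _) _; exact: rank_leq_col.
by rewrite leqNgt rW.
Qed.

Lemma char_poly_similar (K : fieldType) n (P B : 'M[K]_n) (D : 'rV[K]_n) :
  P \in unitmx -> P *m B = diag_mx D *m P ->
  char_poly B = \prod_i ('X - (D 0 i)%:P).
Proof.
move=> Pu PB.
have -> : \prod_i ('X - (D 0 i)%:P) = char_poly (diag_mx D).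
  rewrite char_poly_trig ?diag_mx_is_trig//.
  by apply: eq_bigr => i _; rewrite mxE eqxx.
have : map_mx polyC P *m char_poly_mx B = char_poly_mx (diag_mx D) *m map_mx polyC P.
  rewrite /char_poly_mx mulmxBr mulmxBl -!map_mxM PB.
  by rewrite scalar_mxC.
move/(congr1 determinant); rewrite !det_mulmx mulrC => /mulIf; apply.
by rewrite det_map_mx polyC_eq0 -unitfE -unitmxE.
Qed.

End StablePair.

(** * Selection and stability of two multipliers *)

Section Multipliers.
Variable R : realType.

(** An eigenbasis is invertible, so Y times the eigenbasis still has rank 2 and two of its columns
    are nonzero; the corresponding eigenvalues are stable by hypothesis. Divisibility of the
    characteristic polynomial by the product of the two factors is what expresses counting with
    multiplicity. *)
Lemma stable_pair (B : 'M[R]_3) (Y : 'M[R]_(2, 3)) :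
  \rank Y = 2%N -> diagonalizable (complexify B) ->
  (forall mu a b, eigenpair B mu a b -> Y *m a <> 0 \/ Y *m b <> 0 ->
     `|mu| < 1) ->
  exists (mu1 mu2 : R[i]) (a b : 'cV[R]_3),
    [/\ `|mu1| < 1, `|mu2| < 1,
        ('X - mu1%:P) * ('X - mu2%:P) %| char_poly (complexify B)
      & independent a b] /\
    ([/\ complex.Im mu1 = 0, complex.Im mu2 = 0,
         B *m a = complex.Re mu1 *: a & B *m b = complex.Re mu2 *: b] \/
     [/\ complex.Im mu1 != 0, mu2 = conjc mu1 & eigenpair B mu1 a b]).
Proof.
move=> rY [P Pu /diagonalizable_forPex[D /simmxPp PBD]] mu_lt1.
have {PBD} PB : P *m complexify B = diag_mx D *m P.
  by apply: PBD; exact: stablemx_unit.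
have chB := char_poly_similar Pu PB.
(* Diagonalizability supplies row eigenvectors, the rows of P; the columns of its inverse are the
   column eigenvectors. *)
pose S := invmx P.
have Su : S \in unitmx by rewrite unitmx_inv.
pose a j := map_mx (@complex.Re R) (col j S).
pose b j := map_mx (@complex.Im R) (col j S).
have BS j : eigenpair B (D 0 j) (a j) (b j).
  apply/eigenpairP; rewrite cplx_ReIm.
  have : complexify B *m S = S *m diag_mx D.
    apply: (can_inj (mulKmx Pu)); rewrite !mulmxA PB.
    by rewrite /S -[LHS]mulmxA mulmxV// mulmx1 mul1mx.
  move/(congr1 (col j)); rewrite !colE -mulmxA => ->.
  rewrite -!mulmxA scalemxAr; congr (_ *m _).
  by rewrite -colE; apply/matrixP => k l; rewrite (ord1 l) !mxE eqxx andbT;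
    case: eqVneq => [->|]; rewrite ?mulr1 ?mulr0.
have YS j : col j (complexify Y *m S) != 0 -> Y *m a j <> 0 \/ Y *m b j <> 0.
  move=> YSj; apply: contrapT => /not_orP[/contrapT Ya /contrapT Yb].
  move/eqP : YSj; apply; rewrite colE -mulmxA -colE -(cplx_ReIm (col j S)).
  by rewrite mul_cplx Ya Yb; apply/matrixP => k l; rewrite !mxE.
have [i [j [ij /YS Yi /YS Yj]]] : exists i j,
    [/\ i != j, col i (complexify Y *m S) != 0 & col j (complexify Y *m S) != 0].
  apply: two_nonzero_columns; rewrite mxrankMfree ?row_free_unit//.
  by rewrite mxrank_map rY.
(* A non-real eigenvalue is joined to its conjugate, whatever the other selected column is. The
   conjugate is a root because B is real, and the two roots are distinct, so the product of the
   factors divides. *)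
have conj_case k : Y *m a k <> 0 \/ Y *m b k <> 0 -> complex.Im (D 0 k) != 0 ->
  exists (mu1 mu2 : R[i]) (a b : 'cV[R]_3),
    [/\ `|mu1| < 1, `|mu2| < 1,
        ('X - mu1%:P) * ('X - mu2%:P) %| char_poly (complexify B)
      & independent a b] /\
    ([/\ complex.Im mu1 = 0, complex.Im mu2 = 0,
         B *m a = complex.Re mu1 *: a & B *m b = complex.Re mu2 *: b] \/
     [/\ complex.Im mu1 != 0, mu2 = conjc mu1 & eigenpair B mu1 a b]).
  move=> Yk mu0; have mu1 := mu_lt1 _ _ _ (BS k) Yk.
  exists (D 0 k), (conjc (D 0 k)), (a k), (b k); split; last by right.
  split => //; first by rewrite normcJ.
  - have ne : D 0 k != conjc (D 0 k).
      apply: contra mu0; case: (D 0 k) => x y; rewrite eq_complex/= eqxx/=.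
      by rewrite -subr_eq0 opprK -mulr2n mulrn_eq0.
    have rk : root (char_poly (complexify B)) (D 0 k).
      by rewrite chB (bigD1 k)//= rootM root_XsubC eqxx.
    have rk' : root (char_poly (complexify B)) (conjc (D 0 k)).
      rewrite -complex_root_conj.
      have -> : map_poly conjc (char_poly (complexify B)) =
          char_poly (map_mx conjc (complexify B)).
        exact: map_char_poly.
      suff -> : map_mx conjc (complexify B) = complexify B by [].
      by apply/matrixP => p q; rewrite !mxE conjc_real.
    have := @uniq_roots_dvdp _ (char_poly (complexify B))
      [:: D 0 k; conjc (D 0 k)].
    rewrite big_cons big_seq1; apply; first by rewrite /= rk rk'.
    by rewrite uniq_rootsE/= inE ne.
  - apply: nonreal_eigenpair_independent (BS k) mu0 _.
    by case: Yk => Yk; [left|right] => z0; apply: Yk; rewrite z0 mulmx0.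
have [mui0|] := eqVneq (complex.Im (D 0 i)) 0; last exact: conj_case.
have [muj0|] := eqVneq (complex.Im (D 0 j)) 0; last exact: conj_case.
have Di := mu_lt1 _ _ _ (BS i) Yi; have Dj := mu_lt1 _ _ _ (BS j) Yj.
have BSr k : complex.Im (D 0 k) = 0 ->
    B *m a k = complex.Re (D 0 k) *: a k /\ B *m b k = complex.Re (D 0 k) *: b k.
  by case: (BS k) => Ba Bb mu0; rewrite Ba Bb mu0 !scale0r subr0 add0r.
have [Bai Bbi] := BSr i mui0; have [Baj Bbj] := BSr j muj0.
(* Both eigenvalues are real, so real and imaginary parts of the columns are real eigenvectors,
   though some may be zero or dependent. A nonzero complex minor of the columns i and j is a
   combination of four real minors, one of which must be nonzero. *)
have [u [v [Bu Bv uv]]] : exists u v, [/\ B *m u = complex.Re (D 0 i) *: u,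
    B *m v = complex.Re (D 0 j) *: v & independent u v].
  have [k [l]] := nonzero_minor Su ij.
  pose mn (x y : 'cV[R]_3) := x k 0 * y l 0 - x l 0 * y k 0.
  have -> : S k i * S l j - S l i * S k j =
      Complex (mn (a i) (a j) - mn (b i) (b j)) (mn (a i) (b j) + mn (b i) (a j)).
    rewrite /mn !mxE; case: (S k i) (S l j) (S l i) (S k j) => [? ?] [? ?] [? ?] [? ?].
    by apply/eqP; rewrite eq_complex/=; apply/andP; split; apply/eqP; ring.
  have [m1|/minor_independent ?] := eqVneq (mn (a i) (a j)) 0; last by exists (a i), (a j).
  have [m2|/minor_independent ?] := eqVneq (mn (b i) (b j)) 0; last by exists (b i), (b j).
  have [m3|/minor_independent ?] := eqVneq (mn (a i) (b j)) 0; last by exists (a i), (b j).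
  have [m4|/minor_independent ?] := eqVneq (mn (b i) (a j)) 0; last by exists (b i), (a j).
  by rewrite m1 m2 m3 m4 subrr addr0 eqxx.
(* The indices i and j differ even if the eigenvalues coincide, so both factors occur in the product
   over the diagonal. *)
exists (D 0 i), (D 0 j), u, v; split; last by left.
split => //; rewrite chB (bigD1 i)//= (bigD1 j) 1?eq_sym//= mulrA.
exact: dvdp_mulr.
Qed.

(** Two oscillators are treated at once, for the real and imaginary parts of one complex solution.
    [V] is nonincreasing; if m >= 1 then V(T) >= V(0), so [V] is constant on [0, T]. *)
Lemma damped_oscillator_contraction (nu1 nu2 T m : R) (a1 b1 a2 b2 : R -> R) :
  0 < nu1 -> 0 < nu2 -> 0 < T ->
  (forall t : R, is_derive t 1 a1 (b1 t)) ->
  (forall t : R, is_derive t 1 b1 (- nu1 * a1 t - nu2 * b1 t)) ->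
  (forall t : R, is_derive t 1 a2 (b2 t)) ->
  (forall t : R, is_derive t 1 b2 (- nu1 * a2 t - nu2 * b2 t)) ->
  let V t := nu1 * (a1 t ^+ 2 + a2 t ^+ 2) + (b1 t ^+ 2 + b2 t ^+ 2) in
  V T = m * V 0 -> V 0 != 0 -> m < 1.
Proof.
move=> nu1_gt0 nu2_gt0 T0 da1 db1 da2 db2 V VT V0.
have V_ge0 t : 0 <= V t.
  by rewrite addr_ge0 ?mulr_ge0 ?addr_ge0 ?sqr_ge0// ltW.
rewrite ltNge; apply/negP => m1.
have dV (t : R) : is_derive t 1 V (- (2 * nu2) * (b1 t ^+ 2 + b2 t ^+ 2)).
  have -> : V = (nu1 *: (a1 ^+ 2 + a2 ^+ 2) + (b1 ^+ 2 + b2 ^+ 2)) by [].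
  have h1 := da1 t; have h2 := db1 t; have h3 := da2 t; have h4 := db2 t.
  have dX := @is_deriveX _ R.
  have dN := @is_deriveD _ _ _ _ _ _ _ _ _ (@is_deriveZ _ _ _ _ nu1 _ _ _
    (@is_deriveD _ _ _ _ _ _ _ _ _ (dX _ 2%N _ _ _ h1) (dX _ 2%N _ _ _ h3)))
    (@is_deriveD _ _ _ _ _ _ _ _ _ (dX _ 2%N _ _ _ h2) (dX _ 2%N _ _ _ h4)).
  apply: (is_derive_eq dN).
  rewrite /GRing.scale/= !expr1.
  ring.
have Vdec s t : 0 <= s -> s <= t -> t <= T -> V t <= V s.
  apply: (@ler0_derive1_nincr _ V 0 T).
  - by move=> x _; case: (dV x).
  - move=> x _; rewrite derive1E; case: (dV x) => _ ->.
    by rewrite mulNr oppr_le0 mulr_ge0 ?addr_ge0 ?sqr_ge0 ?mulr_ge0// ltW.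
  - by apply: derivable_within_continuous => x _; case: (dV x).
have Vcst t : 0 <= t -> t <= T -> V t = V 0.
  move=> t0 tT; apply/eqP; rewrite eq_le Vdec//=.
  by apply: le_trans (Vdec t T t0 tT (lexx T)); rewrite VT ler_peMl.
have itv_near (t : R) : 0 < t < T -> \forall s \near t, 0 < s < T.
  move=> /andP[t0 tT]; have := @near_in_itvoo R 0 T t.
  by rewrite in_itv/= t0 tT => /(_ isT); apply: filterS => s; rewrite in_itv.
have b0 t : 0 < t < T -> b1 t = 0 /\ b2 t = 0.
  move=> tT; have : 'D_1 V t = 0.
    rewrite (@near_eq_derive _ _ _ V (cst (V 0))) ?derive_cst//.
    by apply: filterS (itv_near t tT) => s /andP[s0 sT]; rewrite Vcst ?ltW.
  case: (dV t) => _ -> /eqP; rewrite mulf_eq0 oppr_eq0 mulf_eq0 pnatr_eq0/=.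
  rewrite (gt_eqF nu2_gt0)/= paddr_eq0 ?sqr_ge0// !sqrf_eq0.
  by move=> /andP[/eqP -> /eqP ->].
(* Any interior time would do: velocities vanish on a neighbourhood of it, so their derivatives
   vanish there too, and the equation leaves nu1 times the position equal to 0. *)
have tT : 0 < T / 2 < T by apply/andP; split; lra.
have zero (a b : R -> R) :
    is_derive (T / 2) 1 b (- nu1 * a (T / 2) - nu2 * b (T / 2)) ->
    (forall t, 0 < t < T -> b t = 0) -> a (T / 2) = 0.
  move=> db bz; have : 'D_1 b (T / 2) = 0.
    rewrite (@near_eq_derive _ _ _ b (cst 0)) ?derive_cst//.
    by apply: filterS (itv_near _ tT) => s /bz.
  case: db => _ ->; rewrite bz// mulr0 subr0 => /eqP.
  by rewrite mulf_eq0 oppr_eq0 gt_eqF//= => /eqP.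
move/eqP : V0; apply; rewrite -(Vcst (T / 2)) /V; try lra.
rewrite (zero a1 b1)//; last by move=> t /b0[].
rewrite (zero a2 b2)//; last by move=> t /b0[].
by have [-> ->] := b0 _ tT; rewrite expr0n/= addr0 mulr0 addr0.
Qed.

Lemma multiplier_lt1 (nu1 nu2 T : R) (B : 'M[R]_3) (Y : R -> 'M[R]_(2, 3)) :
  0 < nu1 -> 0 < nu2 -> 0 < T ->
  (forall (t : R) j, is_derive t 1 (fun t => Y t 0 j) (Y t 1 j)) ->
  (forall (t : R) j, is_derive t 1 (fun t => Y t 1 j)
    (- nu1 * Y t 0 j - nu2 * Y t 1 j)) ->
  Y T = Y 0 *m B ->
  forall mu a b, eigenpair B mu a b -> Y 0 *m a <> 0 \/ Y 0 *m b <> 0 ->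
    `|mu| < 1.
Proof.
move=> nu1_gt0 nu2_gt0 T0 dY0 dY1 YT mu a b [Ba Bb] Yab.
have dYv (v : 'cV[R]_3) (t : R) :
    is_derive t 1 (fun t => (Y t *m v) 0 0) ((Y t *m v) 1 0) /\
    is_derive t 1 (fun t => (Y t *m v) 1 0)
      (- nu1 * (Y t *m v) 0 0 - nu2 * (Y t *m v) 1 0).
  have YE i : (fun t => (Y t *m v) i 0) = \sum_j (v j 0 *: (fun t => Y t i j)).
    apply/funext => s; rewrite fct_sumE mxE; apply: eq_bigr => j _.
    by rewrite mulrC.
  split; rewrite YE.
    have -> : (Y t *m v) 1 0 = \sum_j v j 0 *: Y t 1 j.
      by rewrite mxE; apply: eq_bigr => j _; rewrite mulrC.
    by apply: is_derive_sum => j; exact: is_deriveZ.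
  have -> : - nu1 * (Y t *m v) 0 0 - nu2 * (Y t *m v) 1 0 =
      \sum_j v j 0 *: (- nu1 * Y t 0 j - nu2 * Y t 1 j).
    rewrite !mxE !mulr_sumr -sumrB; apply: eq_bigr => j _.
    by rewrite /GRing.scale/=; ring.
  by apply: is_derive_sum => j; exact: is_deriveZ.
have := @damped_oscillator_contraction nu1 nu2 T
  (complex.Re mu ^+ 2 + complex.Im mu ^+ 2)
  (fun t => (Y t *m a) 0 0) (fun t => (Y t *m a) 1 0)
  (fun t => (Y t *m b) 0 0) (fun t => (Y t *m b) 1 0)
  nu1_gt0 nu2_gt0 T0 (fun t => (dYv a t).1) (fun t => (dYv a t).2)
  (fun t => (dYv b t).1) (fun t => (dYv b t).2).
(* The contraction factor is m = |mu|^2, as (p u - q v)^2 + (q u + p v)^2 = (p^2 + q^2)(u^2 + v^2)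
   in each coordinate. *)
move=> /= mu1; rewrite normc_def -[1]/(1%:C)%C ltcR.
rewrite -[ltRHS]sqrtr1 ltr_sqrt//; apply: mu1.
  rewrite YT -!mulmxA Ba Bb mulmxBr mulmxDr -!scalemxAr !mxE.
  by ring.
(* A vanishing initial energy would mean that Y(0) kills both [a] and [b]. *)
apply/eqP => /eqP; rewrite paddr_eq0; last 2 first.
- by rewrite mulr_ge0 ?addr_ge0 ?sqr_ge0// ltW.
- by rewrite addr_ge0 ?sqr_ge0.
rewrite mulf_eq0 gt_eqF//= !paddr_eq0 ?sqr_ge0// !sqrf_eq0.
move=> /andP[/andP[/eqP a0 /eqP b0] /andP[/eqP a1 /eqP b1]].
have two (v : 'cV[R]_3) :
    (Y 0 *m v) 0 0 = 0 -> (Y 0 *m v) 1 0 = 0 -> Y 0 *m v = 0.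
  move=> v0 v1; apply/matrixP => k l; rewrite (ord1 l) [RHS]mxE.
  by case: k => -[|[|//]] lk; [rewrite -[RHS]v0|rewrite -[RHS]v1];
    congr (_ _ _); exact: val_inj.
by case: Yab; apply; exact: two.
Qed.

End Multipliers.

(** * Floquet solutions of the stable pair *)

Section FloquetPair.
Variables (R : realType) (A X : R -> 'M[R]_3) (P : R).
Hypotheses (cA : continuous A) (pA : periodic A P) (P0 : 0 < P).
Hypothesis XA : principal_fundamental A X.

Lemma re_part_cplx (a b : R -> 'cV[R]_3) :
  re_part (fun s => cplx (a s) (b s)) = a.
Proof. by apply/funext => s; rewrite /re_part map_Re_cplx. Qed.

Lemma im_part_cplx (a b : R -> 'cV[R]_3) :
  im_part (fun s => cplx (a s) (b s)) = b.
Proof. by apply/funext => s; rewrite /im_part map_Im_cplx. Qed.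

Lemma floquet_solution_cplx mu a b :
  eigenpair (X P) mu a b -> a <> 0 \/ b <> 0 ->
  floquet_solution A P mu (fun s => cplx (X s *m a) (X s *m b)).
Proof.
move=> [Ba Bb] ab0; split; rewrite ?re_part_cplx ?im_part_cplx.
- by split=> s _; exact: fundamental_solution.
- exists 0; case: XA => -> _; rewrite !mul1mx; apply/eqP => /cplx_eq0[a0 b0].
  by case: ab0; apply.
- move=> s; rewrite scale_cplx !(fundamental_monodromy cA pA XA) -!mulmxA.
  by rewrite Ba Bb mulmxBr mulmxDr -!scalemxAr.
Qed.

(** The parts X a and X b mix under translation by a period, but the sum of their squared norms is
    multiplied by exactly |mu|^2. *)
Lemma stable_eigenpair_cvg0 mu a b : eigenpair (X P) mu a b -> `|mu| < 1 ->
  (X s *m a @[s --> +oo] --> (0 : 'cV[R]_3)) /\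
  (X s *m b @[s --> +oo] --> (0 : 'cV[R]_3)).
Proof.
move=> [Ba Bb] mu1.
pose E s := \sum_i ((X s *m a) i 0 ^+ 2 + (X s *m b) i 0 ^+ 2).
have E0 : E s @[s --> +oo] --> (0 : R).
  apply: (@cvg_contracting_period _ E P (complex.Re mu ^+ 2 + complex.Im mu ^+ 2)).
  - exact: P0.
  - rewrite addr_ge0 ?sqr_ge0//=.
    move: mu1; rewrite normc_def -[1]/(1%:C)%C ltcR.
    by rewrite -[ltRHS]sqrtr1 ltr_sqrt.
  - have cX (v : 'cV[R]_3) i : continuous (fun s => (X s *m v) i 0).
      move=> s; apply: differentiable_continuous; apply/derivable1_diffP.
      by case: (is_derive_coord i ord0 (fundamental_solution XA v s)).
    move=> s; rewrite /E /continuous_at.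
    by apply: cvg_sumr => i; apply: cvgD; apply: cvgM; exact: cX.
  - by move=> s; apply: sumr_ge0 => i _; rewrite addr_ge0 ?sqr_ge0.
  - move=> s; rewrite /E mulr_sumr; apply: eq_bigr => i _.
    rewrite !(fundamental_monodromy cA pA XA) -!mulmxA Ba Bb.
    rewrite mulmxBr mulmxDr -!scalemxAr.
    move: (X s *m a) (X s *m b) => u v; rewrite !mxE; ring.
have sub (v : R -> 'cV[R]_3) : (forall s i, v s i 0 ^+ 2 <= E s) ->
    v s @[s --> +oo] --> (0 : 'cV[R]_3).
  move=> vE; apply: cvg_mxP => i j; rewrite (ord1 j) mxE.
  apply/cvgrPdist_lt => e e0.
  have e20 : 0 < e ^+ 2 by exact: exprn_gt0.
  move/cvgrPdist_lt : E0 => /(_ _ e20); apply: filterS => s.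
  rewrite !sub0r !normrN => Es.
  rewrite -(ltr_pXn2r (n := 2)) ?nnegrE ?normr_ge0 ?ltW// real_normK ?num_real//.
  by apply: le_lt_trans (vE s i) _; apply: le_lt_trans Es; exact: ler_norm.
have term s i : (X s *m a) i 0 ^+ 2 + (X s *m b) i 0 ^+ 2 <= E s.
  rewrite /E (bigD1 i)//= lerDl; apply: sumr_ge0 => j _.
  by rewrite addr_ge0 ?sqr_ge0.
split; apply: sub => s i; apply: le_trans (term s i).
  by rewrite lerDl sqr_ge0.
by rewrite lerDr sqr_ge0.
Qed.

(** Common to the real and the conjugate case: in both the span is that of X(s) a and X(s) b. A
    solution starting in it is X(s) (x a + y b) with constant x and y, which gives invariance and
    decay together. *)
Lemma stable_span (a b : 'cV[R]_3) (e1 e2 : R -> 'cV[R[i]]_3) :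
  independent a b ->
  (forall s, floquet_span e1 e2 s = <<[:: X s *m a; X s *m b]>>%VS) ->
  X s *m a @[s --> +oo] --> (0 : 'cV[R]_3) ->
  X s *m b @[s --> +oo] --> (0 : 'cV[R]_3) ->
  (forall s, \dim (floquet_span e1 e2 s) = 2%N) /\
  forall (s0 : R) (z : R -> 'cV[R]_3),
    solution_on [set s | s0 <= s] A z -> z s0 \in floquet_span e1 e2 s0 ->
    (forall s, s0 <= s -> z s \in floquet_span e1 e2 s) /\
    z s @[s --> +oo] --> (0 : 'cV[R]_3).
Proof.
move=> ab spanE Xa0 Xb0.
have memE s u : u \in floquet_span e1 e2 s <->
    exists x y : R, u = X s *m (x *: a + y *: b).
  rewrite spanE span_cons span_seq1; split.
    move=> /memv_addP[_ /vlineP[x ->] [_ /vlineP[y ->] ->]].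
    by exists x, y; rewrite mulmxDr -!scalemxAr.
  move=> [x [y ->]]; rewrite mulmxDr -!scalemxAr.
  by apply: memv_add; apply: memvZ; exact: memv_line.
split=> [s|s0 z dz /memE[x [y zs0]]].
  rewrite spanE; apply/eqP; rewrite -[2%N]/(size [:: X s *m a; X s *m b]).
  have /freeP : forall k : 'I_2 -> R, \sum_(i < 2) k i *:
      (in_tuple [:: X s *m a; X s *m b])`_i = 0 -> forall i, k i = 0.
    move=> k; rewrite big_ord_recl big_ord1/= !scalemxAr -mulmxDr => k0.
    have : k ord0 *: a + k (lift ord0 ord0) *: b = 0.
      by rewrite -(mulKmx (fundamental_unit cA XA s) (_ + _)) k0 mulmx0.
    move=> /ab[k1 k2] i; case: (unliftP ord0 i) => [j ->|->//].
    by rewrite (ord1 j).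
  exact.
have zE := solution_forward cA XA dz zs0.
split=> [s s0s|]; first by rewrite zE//; apply/memE; exists x, y.
have : X s *m (x *: a + y *: b) @[s --> +oo] --> (0 : 'cV[R]_3).
  have -> : (fun s => X s *m (x *: a + y *: b)) =
      (fun s => x *: (X s *m a) + y *: (X s *m b)).
    by apply/funext => s; rewrite mulmxDr -!scalemxAr.
  have := cvgD (cvgZ (cvg_cst x) Xa0) (cvgZ (cvg_cst y) Xb0).
  by rewrite !scaler0 addr0; apply.
apply: cvg_trans; apply: near_eq_cvg.
exists s0; split; first exact: num_real.
by move=> s /ltW s0s; rewrite zE.
Qed.

Lemma stable_floquet_pair (mu1 mu2 : R[i]) (a b : 'cV[R]_3) :
  `|mu1| < 1 -> `|mu2| < 1 -> independent a b ->
  ([/\ complex.Im mu1 = 0, complex.Im mu2 = 0,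
       X P *m a = complex.Re mu1 *: a & X P *m b = complex.Re mu2 *: b] \/
   [/\ complex.Im mu1 != 0, mu2 = conjc mu1 & eigenpair (X P) mu1 a b]) ->
  exists e1 e2 : R -> 'cV[R[i]]_3,
    [/\ floquet_solution A P mu1 e1, floquet_solution A P mu2 e2,
        lin_indep e1 e2
      & real_floquet_pair mu1 mu2 e1 e2 \/ conj_floquet_pair mu1 mu2 e1 e2] /\
    [/\ forall s, \dim (floquet_span e1 e2 s) = 2%N
      & forall (s0 : R) (z : R -> 'cV[R]_3),
          solution_on [set s | s0 <= s] A z -> z s0 \in floquet_span e1 e2 s0 ->
          (forall s, s0 <= s -> z s \in floquet_span e1 e2 s) /\
          z s @[s --> +oo] --> (0 : 'cV[R]_3)].
Proof.
move=> mu1_lt1 mu2_lt1 ab.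
have X0 : X 0 = 1%:M by case: XA.
have a0 : a <> 0.
  move=> a0; have [] := ab 1 0; first by rewrite a0 scaler0 scale0r addr0.
  by move/eqP; rewrite oner_eq0.
have b0 : b <> 0.
  move=> b0; have [] := ab 0 1; first by rewrite b0 scaler0 scale0r addr0.
  by move=> _ /eqP; rewrite oner_eq0.
case=> [[im1 im2 Ba Bb]|[im1 mu2E Bab]].
  have pa : eigenpair (X P) mu1 a 0.
    by split; rewrite ?mulmx0 im1 !scale0r ?scaler0 ?subr0 ?addr0.
  have pb : eigenpair (X P) mu2 b 0.
    by split; rewrite ?mulmx0 im2 !scale0r ?scaler0 ?subr0 ?addr0.
  (* The zero imaginary part is written [X s *m 0], so that the lemmas on pairs apply to real
     multipliers as well. *)
  exists (fun s => cplx (X s *m a) (X s *m 0)), (fun s => cplx (X s *m b) (X s *m 0)).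
  split; last first.
    have [] := @stable_span a b (fun s => cplx (X s *m a) (X s *m 0))
       (fun s => cplx (X s *m b) (X s *m 0)) ab => //.
    - move=> s; rewrite /floquet_span !re_part_cplx !im_part_cplx mulmx0.
      rewrite !span_cons span_nil.
      have -> : <[0 : 'cV[R]_3]>%VS = 0%VS by apply/eqP; rewrite -subv0 -memvE mem0v.
      by rewrite !addv0 !add0v.
    - by case: (stable_eigenpair_cvg0 pa mu1_lt1).
    - by case: (stable_eigenpair_cvg0 pb mu2_lt1).
  split.
  - by apply: floquet_solution_cplx => //; left.
  - by apply: floquet_solution_cplx => //; left.
  - move=> x y /(_ 0); rewrite X0 !mul1mx !scale_cplx addr_cplx.
    rewrite !scaler0 !subr0 !addr0 => /cplx_eq0[/ab[xr yr] /ab[xi yi]].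
    by split; apply/eqP; rewrite eq_complex/= ?xr ?yr ?xi ?yi !eqxx.
  - by left; split=> // s; rewrite !im_part_cplx mulmx0.
have pb : eigenpair (X P) mu2 a (- b).
  case: Bab => Ba Bb; split; first by rewrite Ba mu2E; case: (mu1) => p q/=;
    rewrite scalerN scaleNr opprK.
  by rewrite mulmxN Bb mu2E; case: (mu1) => p q/=; rewrite scalerN scaleNr opprD.
exists (fun s => cplx (X s *m a) (X s *m b)), (fun s => cplx (X s *m a) (X s *m - b)).
split; last first.
  have [Xa Xb] := stable_eigenpair_cvg0 Bab mu1_lt1.
  have [] := @stable_span a b (fun s => cplx (X s *m a) (X s *m b))
     (fun s => cplx (X s *m a) (X s *m - b)) ab => //.
  move=> s; rewrite /floquet_span !re_part_cplx !im_part_cplx mulmxN.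
  rewrite !span_cons span_nil !addv0.
  have -> : <[- (X s *m b)]>%VS = <[X s *m b]>%VS.
    apply/eqP; rewrite eqEsubv -!memvE memvN memv_line/=.
    by rewrite -[X in X \in _]opprK memvN memv_line.
  by rewrite addvA addvv.
split.
- by apply: floquet_solution_cplx => //; left.
- by apply: floquet_solution_cplx => //; left.
(* At s = 0 the complex relation reads (x1 + y1) a + (y2 - x2) b = 0 and (x2 + y2) a + (x1 - y1) b =
   0; real independence of a and b makes all four coefficients vanish. *)
- move=> [x1 x2] [y1 y2] /(_ 0); rewrite X0 !mul1mx !scale_cplx addr_cplx/=.
  move=> /cplx_eq0[].
  have -> : x1 *: a - x2 *: b + (y1 *: a - y2 *: - b) =
      (x1 + y1) *: a + (y2 - x2) *: b.
    by apply/matrixP => k l; rewrite !mxE; ring.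
  have -> : x2 *: a + x1 *: b + (y2 *: a + y1 *: - b) =
      (x2 + y2) *: a + (x1 - y1) *: b.
    by apply/matrixP => k l; rewrite !mxE; ring.
  move=> /ab[h1 h2] /ab[h3 h4].
  by split; apply/eqP; rewrite eq_complex/=; apply/andP; split; apply/eqP; lra.
- by right; split=> // s; rewrite conj_cplx mulmxN.
Qed.

End FloquetPair.

(** * Interchange of derivatives *)

Section Interchange.
Variable R : realType.

(** The conditions are imposed on the whole ball around [a] of radius |b - a|, so that the order of
    [a] and [b] is immaterial. *)
Lemma mean_value_bound (f df : R -> R) (a b c e : R) :
  (forall x, `|x - a| <= `|b - a| -> is_derive x 1 f (df x)) ->
  (forall x, `|x - a| <= `|b - a| -> `|c - df x| <= e) ->
  `|f b - f a - c * (b - a)| <= e * `|b - a|.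
Proof.
move=> dfx dfc.
have bnd x : x \in `[Num.min a b, Num.max a b] -> `|x - a| <= `|b - a|.
  rewrite in_itv/=; case: (leP a b) => ab /andP[ax xb].
    by rewrite !ger0_norm ?subr_ge0// lerB.
  by rewrite [leLHS]distrC [leRHS]distrC !ger0_norm ?subr_ge0 ?(ltW ab)// lerB.
have [x xab fab] : exists2 x, `|x - a| <= `|b - a| & f b - f a = df x * (b - a).
  case: (leP a b) bnd => ab bnd.
    have [| |x xab ->] := @MVT_segment R f df a b ab.
    - by move=> x /subset_itv_oo_cc/bnd; exact: dfx.
    - by apply: derivable_within_continuous => x /bnd/dfx[].
    by exists x => //; exact: bnd.
  have [| |x xab E] := @MVT_segment R f df b a (ltW ab).
  - by move=> x /subset_itv_oo_cc/bnd; exact: dfx.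
  - by apply: derivable_within_continuous => x /bnd/dfx[].
  exists x; first exact: bnd.
  by rewrite -[LHS]opprB E -mulrN opprB.
by rewrite fab -mulrBl normrM ler_wpM2r// distrC dfc.
Qed.

(** Only the second coordinate has to avoid 0. Limits along this filter are joint in t and d, hence
    uniform for t near t0, and division by d is meaningful. *)
Definition punctured (t0 : R) : set_system (R * R) :=
  within [set p | p.2 != 0] (nbhs (t0, 0 : R)).

Global Instance punctured_filter t0 : Filter (punctured t0).
Proof. exact: within_filter. Qed.

Lemma near_punctured (t0 : R) (P Q : set (R * R)) : nbhs (t0, 0 : R) P ->
  (forall p, p.2 != 0 -> P p -> Q p) -> \forall p \near punctured t0, Q p.
Proof. by move=> nP PQ; apply: filterS nP => p Pp p0; exact: PQ. Qed.

Lemma nbhs_square (t0 : R) (Q : set (R * R)) : nbhs (t0, 0 : R) Q ->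
  exists2 r : R, 0 < r & forall t d, `|t - t0| < r -> `|d| < r -> Q (t, d).
Proof.
move=> /nbhs_ballP[r /= r0 rQ]; exists r => // t d tr dr; apply: rQ.
by split; rewrite /ball/=; [rewrite distrC|rewrite sub0r normrN].
Qed.

(** By the mean value inequality in d, phi(t, d) / d is as close to kap(t0, 0) as the values of kap
    near (t0, 0) are. *)
Lemma cvg_quotient (phi kap : R -> R -> R) (t0 : R) :
  (\forall p \near (t0, 0 : R),
     phi p.1 0 = 0 /\ is_derive (p.2 : R) 1 (phi p.1) (kap p.1 p.2)) ->
  kap p.1 p.2 @[p --> (t0, 0 : R)] --> kap t0 0 ->
  phi p.1 p.2 / p.2 @[p --> punctured t0] --> kap t0 0.
Proof.
move=> dphi ckap; apply/cvgrPdist_le => e e0.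
move/cvgrPdist_le : ckap => /(_ e e0) ckap.
have [r r0 rP] := nbhs_square (filterI dphi ckap).
have : nbhs (t0, 0 : R) [set p | `|p.1 - t0| < r /\ `|p.2| < r].
  apply/nbhs_ballP; exists r => //= p [/= p1 p2]; split.
    by move: p1; rewrite /ball/= distrC.
  by move: p2; rewrite /ball/= sub0r normrN.
apply: filterS => -[t d]/= [tr dr] d0.
have bnd := @mean_value_bound (phi t) (kap t) 0 d (kap t0 0) e.
rewrite !subr0 in bnd.
have phi0 : phi t 0 = 0.
  by have := rP t 0 tr; rewrite normr0 => /(_ r0)[[]].
have dn0 : 0 < `|d| by rewrite normr_gt0.
rewrite distrC -(ler_pM2r dn0) -normrM mulrBl mulfVK//.
rewrite phi0 subr0 in bnd; apply: bnd => x; rewrite subr0 => xd.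
  by have [[_]] := rP t x tr (le_lt_trans xd dr).
by have [] := rP t x tr (le_lt_trans xd dr).
Qed.

(* This replaces the equality of mixed partial derivatives: [phi] is only once
   differentiable, but its [t]-derivative is [d * dphi] with [dphi] continuous
   at [d = 0]. *)
Lemma is_derive_interchange (phi kap dphi : R -> R -> R) (t0 c : R) :
  (\forall t \near t0, phi t 0 = 0 /\ is_derive (0 : R) 1 (phi t) (kap t 0)) ->
  (\forall p \near punctured t0,
     is_derive (p.1 : R) 1 (fun t => phi t p.2) (p.2 * dphi p.1 p.2)) ->
  dphi p.1 p.2 @[p --> punctured t0] --> c ->
  is_derive t0 1 (fun t => kap t 0) c.
Proof.
move=> phi_d phi_t dphic.
suff lim_c : h^-1 *: (kap (h *: 1 + t0) 0 - kap t0 0) @[h --> 0^'] --> c.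
  by apply: DeriveDef; [apply/cvg_ex; exists c|exact: cvg_lim].
have quot : \forall t \near t0, phi t d / d @[d --> 0^'] --> kap t 0.
  apply: filterS phi_d => t [phi0 [dphi0 <-]].
  have -> : (fun d => phi t d / d) =
      (fun h => h^-1 *: (phi t (h *: 1 + 0) - phi t 0)).
    by apply/funext => d; rewrite phi0 subr0 addr0 [d *: 1]mulr1 mulrC.
  exact: dphi0.
apply/cvgrPdist_le => e e0.
move/cvgrPdist_le : dphic => /(_ e e0) dphic.
have [r r0 rP] := nbhs_square (filterI phi_t dphic : nbhs (t0, 0 : R) _).
have quot0 := nbhs_singleton quot.
have /nbhs_ballP[r1 /= r10 r1P] := quot.
near=> h; have h0 : h != 0 by near: h; exact: nbhs_dnbhs_neq.
rewrite [h *: 1]mulr1.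
have hr : `|h| < r by near: h; exact: dnbhs0_lt.
have hr1 : `|h| < r1 by near: h; exact: dnbhs0_lt.
have quoth : phi (h + t0) d / d @[d --> 0^'] --> kap (h + t0) 0.
  have := r1P (h + t0); apply; by rewrite /ball/= distrC addrK.
have dn0 : 0 < `|h| by rewrite normr_gt0.
rewrite distrC -(ler_pM2r dn0) -normrM mulrBl [_ *: _]mulrC mulfVK//.
(* For fixed [h] the estimate is proved with phi(., d) / d in place of kap(., 0). It is a closed
   condition, so it passes to the limit d -> 0. *)
have key : `|(phi (h + t0) d / d - phi t0 d / d) - c * h| @[d --> 0^'] -->
    `|kap (h + t0) 0 - kap t0 0 - c * h|.
  apply: cvg_norm; exact: (cvgB (cvgB quoth quot0) (cvg_cst _)).
apply: (@closed_cvg _ _ 0^' _ _ (fun y => y <= e * `|h|) (@closed_le _ _)) key.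
near=> d; have d0 : d != 0 by near: d; exact: nbhs_dnbhs_neq.
have dr : `|d| < r by near: d; exact: dnbhs0_lt.
(* Mean value inequality in t: phi(., d) / d has derivative dphi(., d), within [e] of [c] uniformly
   in small d. *)
have bnd := @mean_value_bound (fun t => phi t d / d) (dphi^~ d) t0 (h + t0) c e.
rewrite addrK in bnd; apply: bnd => x xh; have xr := le_lt_trans xh hr.
  have [dx _] := rP x d xr dr d0.
  have -> : (fun t => phi t d / d) = d^-1 \*: (phi^~ d).
    by apply/funext => t; rewrite mulrC.
  by apply: is_derive_eq; rewrite /= [_ *: _]mulrA mulVf// mul1r.
by have [_ cx] := rP x d xr dr d0; exact: cx.
Unshelve. all: by end_near.
Qed.

End Interchange.

(** * Calculus of directional derivatives *)

Section DirectionalDerivatives.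
Variable R : realType.
Local Notation state := ('cV[R]_2 * 'cV[R]_2)%type.

Lemma derive_compE (U V W : normedModType R) (f : U -> V) (g : V -> W) x v :
  differentiable f x -> differentiable g (f x) ->
  'D_v (g \o f) x = 'D_('D_v f x) g (f x).
Proof.
move=> df dg; rewrite (deriveE v (differentiable_comp df dg)) (diff_comp df dg).
by rewrite (deriveE v df) (deriveE _ dg).
Qed.

Lemma is_derive_comp (U V W : normedModType R) (f : U -> V) (g : V -> W) x v w :
  differentiable f x -> differentiable g (f x) -> 'D_v f x = w ->
  is_derive x v (g \o f) ('D_w g (f x)).
Proof.
move=> df dg <-; apply: DeriveDef; last exact: derive_compE.
by apply: diff_derivable; exact: differentiable_comp.
Qed.

Lemma differentiable_fst (U V : normedModType R) (x : U * V) :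
  differentiable (fst : U * V -> U) x.
Proof. by apply: linear_differentiable => y; exact: cvg_fst. Qed.

Lemma differentiable_snd (U V : normedModType R) (x : U * V) :
  differentiable (snd : U * V -> V) x.
Proof. by apply: linear_differentiable => y; exact: cvg_snd. Qed.

Lemma derive_fst (U V : normedModType R) (x v : U * V) :
  'D_v (fst : U * V -> U) x = v.1.
Proof.
rewrite deriveE; last exact: differentiable_fst.
by rewrite (diff_lin (f := fst : {linear _ -> _}))// => y; exact: cvg_fst.
Qed.

Lemma derive_snd (U V : normedModType R) (x v : U * V) :
  'D_v (snd : U * V -> V) x = v.2.
Proof.
rewrite deriveE; last exact: differentiable_snd.
by rewrite (diff_lin (f := snd : {linear _ -> _}))// => y; exact: cvg_snd.
Qed.

Lemma derive_pairE (U V W : normedModType R) (f : U -> V) (g : U -> W) x v :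
  differentiable f x -> differentiable g x ->
  'D_v (fun y => (f y, g y)) x = ('D_v f x, 'D_v g x).
Proof.
move=> df dg; rewrite (deriveE v (differentiable_pair df dg)) (diff_pair df dg).
by rewrite (deriveE v df) (deriveE v dg).
Qed.

Lemma cV_sum_delta n (u : 'cV[R]_n) : u = \sum_i u i 0 *: delta_mx i 0.
Proof.
rewrite [LHS]matrix_sum_delta; apply: eq_bigr => i _.
by rewrite big_ord1.
Qed.

Lemma deriveZv (U V : normedModType R) (g : U -> V) x a v :
  differentiable g x -> 'D_(a *: v) g x = a *: 'D_v g x.
Proof. by move=> dg; rewrite !(deriveE _ dg) linearZ. Qed.

Lemma deriveDv (U V : normedModType R) (g : U -> V) x v w :
  differentiable g x -> 'D_(v + w) g x = 'D_v g x + 'D_w g x.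
Proof. by move=> dg; rewrite !(deriveE _ dg) linearD. Qed.

Lemma derive_sumv (U V : normedModType R) (g : U -> V) x n (v : 'I_n -> U) :
  differentiable g x -> 'D_(\sum_i v i) g x = \sum_i 'D_(v i) g x.
Proof.
move=> dg; rewrite (deriveE _ dg) linear_sum; apply: eq_bigr => i _.
by rewrite (deriveE _ dg).
Qed.

Lemma derive_coordE n (V : normedModType R) (g : 'cV[R]_n -> V) x v :
  differentiable g x ->
  'D_v g x = \sum_i v i 0 *: 'D_(delta_mx i 0 : 'cV[R]_n) g x.
Proof.
move=> dg; rewrite {1}(cV_sum_delta v) derive_sumv//.
by apply: eq_bigr => i _; rewrite deriveZv.
Qed.

Lemma pair_sum_delta (u : state) :
  u = \sum_i u.1 i 0 *: ((delta_mx i 0, 0) : state) +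
      \sum_i u.2 i 0 *: ((0, delta_mx i 0) : state).
Proof.
have fst_sum n (F : 'I_n -> state) : (\sum_i F i).1 = \sum_i (F i).1.
  exact: (big_morph fst (fun _ _ => erefl) erefl).
have snd_sum n (F : 'I_n -> state) : (\sum_i F i).2 = \sum_i (F i).2.
  exact: (big_morph snd (fun _ _ => erefl) erefl).
apply: injective_projections => /=; rewrite ?fst_sum ?snd_sum /=.
  under [X in _ + X]eq_bigr do rewrite scaler0.
  by rewrite [X in _ + X]big1_eq addr0 -cV_sum_delta.
under [X in X + _]eq_bigr do rewrite scaler0.
by rewrite [X in X + _]big1_eq add0r -cV_sum_delta.
Qed.

(* In finite dimension, continuity of each ['D_v g] is joint continuity in
   the base point and the direction. *)
Lemma cvg_derive (T : Type) (F : set_system T) {FF : Filter F} (g : state -> R)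
    (x0 v0 : state) (y v : T -> state) :
  (\forall x \near x0, differentiable g x) ->
  (forall w, {for x0, continuous (fun x => 'D_w g x)}) ->
  y t @[t --> F] --> x0 -> v t @[t --> F] --> v0 ->
  'D_(v t) g (y t) @[t --> F] --> 'D_v0 g x0.
Proof.
move=> dg cg yx0 vv0.
pose D (x u : state) := \sum_i u.1 i 0 * 'D_((delta_mx i 0, 0) : state) g x +
  \sum_i u.2 i 0 * 'D_((0, delta_mx i 0) : state) g x.
have DE x u : differentiable g x -> 'D_u g x = D x u.
  move=> dgx; rewrite {1}(pair_sum_delta u) deriveDv// !derive_sumv//.
  by congr (_ + _); apply: eq_bigr => i _; rewrite deriveZv.
have DF : \forall t \near F, D (y t) (v t) = 'D_(v t) g (y t).
  have dgy : F [set t | differentiable g (y t)] by exact: yx0 _ dg.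
  by apply: filterS dgy => t dgt; rewrite DE.
apply: cvg_trans (near_eq_cvg DF) _.
rewrite DE; last exact: nbhs_singleton dg.
have c1 : (v t).1 @[t --> F] --> v0.1 by apply: cvg_comp vv0 _; exact: cvg_fst.
have c2 : (v t).2 @[t --> F] --> v0.2 by apply: cvg_comp vv0 _; exact: cvg_snd.
have cgy w : 'D_w g (y t) @[t --> F] --> 'D_w g x0.
  exact: (@cvg_comp _ _ _ y (fun x => 'D_w g x) F _ _ yx0 (cg w)).
apply: cvgD; apply: cvg_sumr => i; apply: cvgM.
- exact: cvg_coord.
- exact: cgy.
- exact: cvg_coord.
- exact: cgy.
Qed.

End DirectionalDerivatives.

(** * The output along the closed loop *)

Section MatrixContinuity.
Variables (R : realType) (T : Type) (F : set_system T).
Context {FF : Filter F}.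

Lemma cvg_mulmx m n p (B : T -> 'M[R]_(m, n)) (C : T -> 'M[R]_(n, p))
    (B0 : 'M[R]_(m, n)) (C0 : 'M[R]_(n, p)) :
  B x @[x --> F] --> B0 -> C x @[x --> F] --> C0 ->
  B x *m C x @[x --> F] --> B0 *m C0.
Proof.
move=> BB0 CC0; apply: cvg_mxP => i j; rewrite mxE.
under eq_cvg do rewrite mxE.
by apply: cvg_sumr => k; apply: cvgM; exact: cvg_coord.
Qed.

Lemma cvg_trmx m n (B : T -> 'M[R]_(m, n)) (B0 : 'M[R]_(m, n)) :
  B x @[x --> F] --> B0 -> (B x)^T @[x --> F] --> B0^T.
Proof.
move=> BB0; apply: cvg_mxP => i j; rewrite mxE.
by under eq_cvg do rewrite mxE; exact: cvg_coord.
Qed.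

Lemma cvg_det n (B : T -> 'M[R]_n) (B0 : 'M[R]_n) :
  B x @[x --> F] --> B0 -> \det (B x) @[x --> F] --> \det B0.
Proof.
move=> BB0; rewrite /determinant.
apply: cvg_big => [|s _]; first exact: add_continuous.
apply: cvgM; first exact: cvg_cst.
apply: cvg_big => [|i _]; first exact: mul_continuous.
exact: cvg_coord.
Qed.

(** Cofactor formula; invertibility of every B x keeps [invmx] away from its default value on
    singular matrices. *)
Lemma cvg_invmx n (B : T -> 'M[R]_n) (B0 : 'M[R]_n) :
  B x @[x --> F] --> B0 -> (forall x, B x \in unitmx) -> B0 \in unitmx ->
  invmx (B x) @[x --> F] --> invmx B0.
Proof.
move=> BB0 Bu B0u; rewrite /invmx B0u.
under eq_cvg do rewrite Bu.
apply: cvg_mxP => i j; rewrite !mxE.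
under eq_cvg do rewrite !mxE.
apply: cvgM.
  by apply: cvgV; [rewrite -unitfE -unitmxE|exact: cvg_det].
apply: cvgM; first exact: cvg_cst.
apply: cvg_det; apply: cvg_mxP => k l; rewrite !mxE.
by under eq_cvg do rewrite !mxE; exact: cvg_coord.
Qed.

End MatrixContinuity.

Section Output.
Variables (R : realType) (M : 'cV[R]_2 -> 'M[R]_2).
Variables (C : 'cV[R]_2 -> 'cV[R]_2 -> 'M[R]_2) (G F : 'cV[R]_2 -> 'cV[R]_2).
Variables (h : 'cV[R]_2 -> R) (nu1 nu2 : R).
Hypotheses (sys : mechanical_system M C G F) (C2h : C2 h).
Local Notation state := ('cV[R]_2 * 'cV[R]_2)%type.
Local Notation e_ j := (delta_mx j ord0 : 'cV[R]_2).
Let f := closed_loop M C G F h nu1 nu2.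

Definition output (i : 'I_2) (x : state) : R :=
  if i == 0 then h x.1 else lie1 h x.1 x.2.

Let dh q : differentiable h q. Proof. by case: C2h => /(_ q I)[]. Qed.

Let ch w q : {for q, continuous (fun q => 'D_w h q)}.
Proof. by case: C2h => /(_ q I)[_ +] _; apply. Qed.

Let ddh w q : differentiable (fun q => 'D_w h q) q.
Proof. by case: C2h => _ /(_ w)/(_ q I)[]. Qed.

Let cdh v w q : {for q, continuous (fun q => 'D_v (fun q => 'D_w h q) q)}.
Proof. by case: C2h => _ /(_ w)/(_ q I)[_ +]; apply. Qed.

Lemma lie1E q p : lie1 h q p = \sum_j 'D_(e_ j) h q * p j 0.
Proof. by rewrite /lie1 mxE; apply: eq_bigr => j _; rewrite mxE. Qed.

Let outputE1 : output 1 =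
  \sum_j (((fun q => 'D_(e_ j) h q) \o fst) * ((fun p : 'cV[R]_2 => p j 0) \o snd)).
Proof.
by apply/funext => x; rewrite fct_sumE /output /= lie1E.
Qed.

Let diff_Dh j (x : state) : differentiable ((fun q => 'D_(e_ j) h q) \o fst) x.
Proof.
by apply: differentiable_comp; [exact: differentiable_fst|exact: ddh].
Qed.

Let diff_coord j (x : state) :
  differentiable ((fun p : 'cV[R]_2 => p j 0) \o snd) x.
Proof.
by apply: differentiable_comp; [exact: differentiable_snd|exact: differentiable_coord].
Qed.

Lemma differentiable_output i (x : state) : differentiable (output i) x.
Proof.
have [->|i0] := eqVneq i 0.
  by apply: differentiable_comp; [exact: differentiable_fst|exact: dh].
have -> : i = 1 by case: i i0 => -[|[|//]] ? ?; exact: val_inj.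
rewrite outputE1; apply: differentiable_sum => j.
by apply: differentiableM.
Qed.

Lemma derive_output0 (x v : state) : 'D_v (output 0) x = 'D_(v.1) h x.1.
Proof.
rewrite -[output 0]/(h \o fst) derive_compE ?derive_fst//.
exact: differentiable_fst.
Qed.

Lemma derive_output1 (x v : state) : 'D_v (output 1) x =
  \sum_j ('D_(e_ j) h x.1 * v.2 j 0 +
          x.2 j 0 * 'D_(v.1) (fun q => 'D_(e_ j) h q) x.1).
Proof.
rewrite outputE1 derive_sum; last first.
  by move=> j; apply: diff_derivable; exact: differentiableM.
apply: eq_bigr => j _; rewrite deriveM; try exact: diff_derivable.
have -> : 'D_v ((fun q => 'D_(e_ j) h q) \o fst) x =
    'D_(v.1) (fun q => 'D_(e_ j) h q) x.1.
  by rewrite derive_compE ?derive_fst//; exact: differentiable_fst.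
have -> : 'D_v ((fun p : 'cV[R]_2 => p j 0) \o snd) x = v.2 j 0.
  rewrite derive_compE ?derive_snd//; last 2 first.
  - exact: differentiable_snd.
  - exact: differentiable_coord.
  have := is_derive_id x.2 v.2; move=> /(is_derive_coord j 0)[_].
  by [].
by [].
Qed.

Lemma continuous_derive_output i w (x : state) :
  {for x, continuous (fun x => 'D_w (output i) x)}.
Proof.
have c1 : y.1 @[y --> x] --> x.1 by exact: cvg_fst.
have c2 : y.2 @[y --> x] --> x.2 by exact: cvg_snd.
have cD v : 'D_v h y.1 @[y --> x] --> 'D_v h x.1.
  exact: (@continuous_cvg _ _ _ _ _ _ (fun q => 'D_v h q) _ (@ch v x.1) c1).
have [->|i0] := eqVneq i 0.
  rewrite /prop_for /continuous_at derive_output0.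
  by under eq_cvg do rewrite derive_output0; exact: cD.
have -> : i = 1 by case: i i0 => -[|[|//]] ? ?; exact: val_inj.
rewrite /prop_for /continuous_at derive_output1.
under eq_cvg do rewrite derive_output1.
apply: cvg_sumr => j; apply: cvgD; apply: cvgM.
- exact: cD.
- exact: cvg_cst.
- by apply: cvg_coord; exact: c2.
- exact: (@continuous_cvg _ _ _ _ _ _ (fun q => 'D_(w.1) (fun q => 'D_(e_ j) h q) q)
    _ (@cdh w.1 (e_ j) x.1) c1).
Qed.

Lemma derive_flow_output0 x : 'D_(f x) (output 0) x = output 1 x.
Proof.
rewrite derive_output0 /output /=; case: x => q p /=.
rewrite derive_coordE; last exact: dh.
by rewrite lie1E; apply: eq_bigr => j _; rewrite mulrC.
Qed.

(** Input-output linearization: the second derivative of h along the flow is the Hessian term plus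
    the gradient applied to the acceleration, and the feedback cancels all of it except -nu1 h - nu2
    L_qdot h. *)
Lemma derive_flow_output1 x : actuation_regular M F h x.1 ->
  'D_(f x) (output 1) x = - nu1 * output 0 x - nu2 * output 1 x.
Proof.
case: x => q p [_ /= gMF].
rewrite derive_output1 big_split/= /output/=.
have -> : \sum_j p j 0 * 'D_p (fun q => 'D_(e_ j) h q) q = lie2 h q p.
  rewrite /lie2 -mulmxA mxE; apply: eq_bigr => j _; rewrite mxE; congr (_ * _).
  rewrite mxE derive_coordE; last exact: ddh.
  by apply: eq_bigr => k _; rewrite !mxE mulrC.
set v := invmx _ *m _.
have -> : \sum_j 'D_(e_ j) h q * v j 0 = (gradient h q *m v) 0 0.
  rewrite mxE; apply: eq_bigr => j _; congr (_ * _); by rewrite mxE.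
rewrite {}/v -opprD mulmxA.
move: gMF; move: (gradient h q *m invmx (M q)) (C q p *m p + G q) => a D gMF.
rewrite mulmxDr mulmxN -scalemxAr.
rewrite [fun_of_matrix (_ + _) _ _]mxE [fun_of_matrix (- _) _ _]mxE.
rewrite [fun_of_matrix (_ *: _) _ _]mxE.
by rewrite mulrAC mulVf// mul1r; ring.
Qed.

(** The differential of (h, L_qdot h) is block triangular with the gradient of h on both diagonal
    blocks, as h does not depend on the velocity. The position part of [w] is chosen first, then the
    velocity part. *)
Lemma output_submersion x (y0 y1 : R) : gradient h x.1 != 0 ->
  exists w, 'D_w (output 0) x = y0 /\ 'D_w (output 1) x = y1.
Proof.
move=> g0.
have [j gj] : exists j, 'D_(e_ j) h x.1 != 0.
  apply: contrapT => all0; move/eqP: g0; apply; apply/matrixP => i j.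
  rewrite !mxE; apply/eqP/negPn/negP => gj; apply: all0; by exists j.
have solve y : exists v, 'D_v h x.1 = y.
  exists ((y / 'D_(e_ j) h x.1) *: e_ j); rewrite deriveZv; last exact: dh.
  by rewrite [_ *: _]divfK.
have [w1 w1E] := solve y0.
have [w2 w2E] := solve (y1 - \sum_j x.2 j 0 * 'D_w1 (fun q => 'D_(e_ j) h q) x.1).
exists (w1, w2); rewrite derive_output0 derive_output1/=; split => //.
rewrite big_split/=; have -> : \sum_j 'D_(e_ j) h x.1 * w2 j 0 = 'D_w2 h x.1.
  rewrite derive_coordE; last exact: dh.
  by apply: eq_bigr => k _; rewrite mulrC.
by rewrite w2E subrK.
Qed.

Lemma C1_continuous (U V : normedModType R) (g : U -> V) x :
  C1 g -> {for x, continuous g}.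
Proof. by move=> /(_ x I)[dg _]; exact: differentiable_continuous. Qed.

Lemma inertia_unit q : M q \in unitmx.
Proof.
have [/(_ q)[_ Mpos] _ _ _] := sys.
rewrite -unitmx_tr -row_free_unit -kermx_eq0; apply/rowV0P => v /sub_kermxP vM.
apply/eqP/negPn/negP => v0.
have := Mpos v^T; rewrite trmx_eq0 => /(_ v0).
rewrite trmxK -mulmxA; have -> : M q *m v^T = 0.
  by apply: trmx_inj; rewrite trmx_mul trmxK trmx0.
by rewrite mulmx0 mxE ltxx.
Qed.

Lemma continuous_closed_loop x : actuation_regular M F h x.1 ->
  {for x, continuous f}.
Proof.
case: x => q p [_ /= gMF].
have [_ _ _ [/(@C1_continuous _ _ _ q) cM /(@C1_continuous _ _ _ (q, p)) cC
  /(@C1_continuous _ _ _ q) cG /(@C1_continuous _ _ _ q) cF]] := sys.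
have c1 : y.1 @[y --> (q, p)] --> q by exact: cvg_fst.
have c2 : y.2 @[y --> (q, p)] --> p by exact: cvg_snd.
have lift (V : normedModType R) (g : 'cV[R]_2 -> V) :
    {for q, continuous g} -> g y.1 @[y --> (q, p)] --> g q.
  by move=> cg; exact: (@continuous_cvg _ _ _ _ _ _ g _ cg c1).
have cMi : invmx (M y.1) @[y --> (q, p)] --> invmx (M q).
  by apply: cvg_invmx; [exact: lift|move=> y|]; exact: inertia_unit.
have cgr : gradient h y.1 @[y --> (q, p)] --> gradient h q.
  apply: cvg_mxP => i j; rewrite [X in _ --> X]mxE.
  have -> : (fun y : state => gradient h y.1 i j) = (fun y => 'D_(e_ j) h y.1).
    by apply/funext => y; rewrite mxE.
  exact: (lift _ (fun q => 'D_(e_ j) h q) (@ch (e_ j) q)).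
have chs : hessian h y.1 @[y --> (q, p)] --> hessian h q.
  apply: cvg_mxP => i j; rewrite [X in _ --> X]mxE.
  have -> : (fun y : state => hessian h y.1 i j) =
      (fun y => 'D_(e_ j) (fun q => 'D_(e_ i) h q) y.1).
    by apply/funext => y; rewrite mxE.
  exact: (lift _ (fun q => 'D_(e_ j) (fun q => 'D_(e_ i) h q) q)
    (@cdh (e_ j) (e_ i) q)).
have cCp : C y.1 y.2 *m y.2 @[y --> (q, p)] --> C q p *m p.
  exact: cvg_mulmx cC c2.
have cl1 : lie1 h y.1 y.2 @[y --> (q, p)] --> lie1 h q p.
  apply: cvg_coord; exact: (cvg_mulmx cgr c2).
have cl2 : lie2 h y.1 y.2 @[y --> (q, p)] --> lie2 h q p.
  apply: cvg_coord; exact: (cvg_mulmx (cvg_mulmx (cvg_trmx c2) chs) c2).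
have chh : h y.1 @[y --> (q, p)] --> h q.
  by apply: lift; apply: differentiable_continuous.
have cFy := lift _ F cF; have cGy := lift _ G cG.
have cu : feedback M C G F h nu1 nu2 (y.1, y.2) @[y --> (q, p)] -->
    feedback M C G F h nu1 nu2 (q, p).
  rewrite /feedback; apply: cvgM.
    apply: cvgV => //; apply: cvg_coord; exact: (cvg_mulmx (cvg_mulmx cgr cMi) cFy).
  apply: cvgD; last first.
    apply: cvg_coord; exact: (cvg_mulmx (cvg_mulmx cgr cMi) (cvgD cCp cGy)).
  apply: cvgB => //; apply: cvgB; apply: cvgM => //; exact: cvg_cst.
rewrite /prop_for /continuous_at.
have -> : f = (fun y => (y.2, invmx (M y.1) *m (- (C y.1 y.2 *m y.2) - G y.1
   + feedback M C G F h nu1 nu2 (y.1, y.2) *: F y.1))).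
  by apply/funext => -[].
have cD : - (C y.1 y.2 *m y.2) - G y.1
    + feedback M C G F h nu1 nu2 (y.1, y.2) *: F y.1 @[y --> (q, p)] -->
    - (C q p *m p) - G q + feedback M C G F h nu1 nu2 (q, p) *: F q.
  exact: cvgD (cvgB (cvgN cCp) cGy) (cvgZ cu cFy).
by have := cvg_pair c2 (cvg_mulmx cMi cD); exact.
Qed.

End Output.

(** * Linearization in transverse coordinates *)

Section TransverseOutputs.
Variable R : realType.
Local Notation state := ('cV[R]_2 * 'cV[R]_2)%type.
Variables (P : R) (U : set state) (f : state -> state).
Variables (tau : state -> R) (xi : state -> 'cV[R]_3).
Variables (V : set (R * 'cV[R]_3)) (Phi : R * 'cV[R]_3 -> state).
Variables (A : R -> 'M[R]_3) (r : R -> 'cV[R]_3 -> 'cV[R]_3).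
Variables (xs : R -> state) (taus : R -> R).
Hypothesis oU : open U.
Hypothesis C1xi : C1_on U xi.
Hypothesis branchU : forall x, U x -> exists t, branch P tau x t.
Hypothesis oV : open V.
Hypothesis C1Phi : C1_on V Phi.
Hypothesis PhiK : forall x, U x -> V (tau x, xi x) /\ Phi (tau x, xi x) = x.
Hypothesis UPhi : forall s z, V (s, z) ->
  [/\ U (Phi (s, z)), eqmod P (tau (Phi (s, z))) s & xi (Phi (s, z)) = z].
Hypothesis Phi_periodic : forall s z (n : int), V (s, z) ->
  V (s + P *~ n, z) /\ Phi (s + P *~ n, z) = Phi (s, z).
Hypothesis pA : periodic A P.
Hypothesis ho : higher_order U tau xi r.
Hypothesis dyn : transverse_dynamics P U f tau xi A r.
Hypothesis Vtaus : forall t, V (taus t, 0).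
Hypothesis Phi_taus : forall t, Phi (taus t, 0) = xs t.
Hypothesis dtaus : forall t : R, derivable taus t 1.
Hypothesis dxs : forall t : R, is_derive t 1 xs (f (xs t)).
Hypothesis cf : forall t, {for xs t, continuous f}.

Lemma periodic_int (B : Type) (g : R -> B) s (n : int) :
  (forall s, g (s + P) = g s) -> g (s + P *~ n) = g s.
Proof.
move=> gP; have gn (m : nat) u : g (u + P *+ m) = g u.
  by elim: m => [|m ih]; [rewrite addr0|rewrite mulrSr addrA gP].
case: n => n; first exact: gn.
by rewrite NegzE mulrNz -(gn n.+1 (s - _)) pmulrn subrK.
Qed.

Lemma Uxs t : U (xs t).
Proof. by rewrite -Phi_taus; case: (UPhi (Vtaus t)). Qed.

Lemma xi_xs t : xi (xs t) = 0.
Proof. by rewrite -Phi_taus; case: (UPhi (Vtaus t)). Qed.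

Lemma differentiable_Phi s z : V (s, z) -> differentiable Phi (s, z).
Proof. by move=> /C1Phi[]. Qed.

Section Branch.
Variables (W : set state) (b : state -> R).
Hypotheses (oW : open W) (C1b : C1_on W b).
Hypothesis Wb : forall y, W y -> eqmod P (tau y) (b y).

Lemma branch_W y : W y -> branch P tau y b.
Proof. by move=> Wy; exists W. Qed.

(** Near x the chart map (b, xi), shifted by whole periods, is a right inverse of [Phi]; the chain
    rule does the rest. *)
Lemma derive_Phi_lift s z v : V (s, z) -> W (Phi (s, z)) ->
  let x := Phi (s, z) in 'D_('D_v b x, 'D_v xi x) Phi (s, z) = v.
Proof.
move=> Vsz Wx x; have [Ux [k1 sE] xiz] := UPhi Vsz.
have [k2 bE] := Wb Wx.
(* Both [s] and [b x] represent tau(x) modulo P; shifting the branch by [n] periods makes it take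
   the value [s] at x. *)
pose n := k1 - k2.
have sbE : b x + P *~ n = s.
  by rewrite sE bE -/x /n mulrzBr addrA addrAC addrK.
pose Psi y := (b y + P *~ n, xi y).
have [db _] := C1b Wx; have [dxi _] := C1xi Ux.
have dbn : differentiable (b + cst (P *~ n)) x by exact: differentiableD.
have Psix : Psi x = (s, z) by rewrite /Psi sbE xiz.
have dPsi : differentiable Psi x by exact: (differentiable_pair dbn dxi).
have id_near : \forall y \near x, y = (Phi \o Psi) y.
  have : nbhs x (W `&` U) by apply: open_nbhs_nbhs; split => //; exact: openI.
  apply: filterS => y [Wy Uy] /=; have [k bk] := Wb Wy.
  have [Vy Phiy] := PhiK Uy.
  have [_] := Phi_periodic (k + n) Vy.
  by rewrite Phiy mulrzDr addrA -bk.
have idE : 'D_v (Phi \o Psi) x = v.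
  by have <- := near_eq_derive v id_near; exact: derive_id.
rewrite -[RHS]idE (derive_compE v dPsi); last first.
  by rewrite Psix; exact: differentiable_Phi.
rewrite Psix.
have dbnE : 'D_v (b + cst (P *~ n)) x = 'D_v b x.
  rewrite deriveD; [|exact: diff_derivable|exact: diff_derivable].
  by rewrite derive_cst addr0.
have PsiE : 'D_v Psi x = ('D_v b x, 'D_v xi x).
  rewrite -dbnE; exact: (derive_pairE v dbn dxi).
by rewrite PsiE.
Qed.

(** The rate d tau / dt along the flow, computed on a branch because tau itself may jump. *)
Definition speed x := 'D_(f x) b x.

Lemma speed_neq0 x : U x -> W x -> speed x != 0.
Proof. by move=> Ux /branch_W Wx; have [] := dyn Ux Wx. Qed.

(** The flow in the chart, with tau as time. Periodicity replaces A(tau x) by A(s); no periodicity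
    of r is assumed, so its argument remains tau(x). *)
Lemma derive_Phi_flow s z : V (s, z) -> W (Phi (s, z)) ->
  let x := Phi (s, z) in
  'D_(1, A s *m z + r (tau x) z) Phi (s, z) = (speed x)^-1 *: f x.
Proof.
move=> Vsz Wx x; have [Ux [k sE] xiz] := UPhi Vsz.
have [sp0 xiE] := dyn Ux (branch_W Wx).
have AE : A (tau x) = A s by rewrite sE periodic_int.
have -> : (1, A s *m z + r (tau x) z) =
    (speed x)^-1 *: (speed x, 'D_(f x) xi x) :> R * 'cV[R]_3.
  rewrite [RHS]surjective_pairing/= xiE -/x xiz AE.
  by congr pair; rewrite [RHS]mulVf.
rewrite deriveZv; last exact: differentiable_Phi.
by rewrite derive_Phi_lift.
Qed.

(** On the orbit the quadratic bound reads |r| <= K * 0. *)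
Lemma remainder_xs t : r (tau (xs t)) 0 = 0.
Proof.
have [K [d [d0 /(_ _ (Uxs t))]]] := ho; rewrite xi_xs.
have -> : euclid_norm (0 : 'cV[R]_3) = 0.
  by rewrite /euclid_norm big1 ?sqrtr0// => i _; rewrite mxE expr0n.
move=> /(_ d0); rewrite expr0n mulr0 /euclid_norm => r0.
have : Num.sqrt (\sum_i r (tau (xs t)) 0 i ord0 ^+ 2) == 0.
  by rewrite eq_le r0 sqrtr_ge0.
rewrite sqrtr_eq0 => rle0.
have : \sum_i r (tau (xs t)) 0 i ord0 ^+ 2 = 0.
  by apply/eqP; rewrite eq_le rle0 sumr_ge0// => i _; exact: sqr_ge0.
move/psumr_eq0P => r00; apply/matrixP => i j; rewrite (ord1 j) [RHS]mxE.
by apply/eqP; rewrite -sqrf_eq0 r00// => k _; exact: sqr_ge0.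
Qed.

(** [taus] is not given as a branch along the orbit. Its rate is found by comparing two expressions
    of f(xs t) as a multiple of the derivative of [Phi] along (1, 0). *)
Lemma derive_taus t : W (xs t) -> 'D_1 taus t = speed (xs t).
Proof.
move=> Wx.
have dPt := differentiable_Phi (Vtaus t).
have dt : differentiable (fun t => (taus t, 0 : 'cV[R]_3)) t.
  by apply: differentiable_pair => //; apply/derivable1_diffP.
have fE : f (xs t) = 'D_1 taus t *: 'D_(1, 0) Phi (taus t, 0).
  rewrite -deriveZv//.
  have -> : 'D_1 taus t *: (1, 0 : 'cV[R]_3) =
      'D_1 (fun t => (taus t, 0 : 'cV[R]_3)) t.
    rewrite derive_pairE//; last by apply/derivable1_diffP.
    rewrite derive_cst; congr pair; last by rewrite scaler0.
    exact: mulr1.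
  rewrite -derive_compE//.
  have -> : Phi \o (fun t => (taus t, 0)) = xs.
    by apply/funext => u; rewrite /= Phi_taus.
  by case: (dxs t) => _ ->.
have := @derive_Phi_flow (taus t) 0 (Vtaus t); rewrite Phi_taus => /(_ Wx)/=.
rewrite remainder_xs mulmx0 addr0 => PhiE; rewrite PhiE scalerA in fE.
have sp0 := speed_neq0 (Uxs t) Wx.
(* The vector field cannot vanish on the orbit, since the speed would then vanish as well. *)
have [f0|f0] := eqVneq (f (xs t)) 0.
  by move: sp0; rewrite /speed f0 derive0 eqxx.
have : (1 - 'D_1 taus t * (speed (xs t))^-1) *: f (xs t) = 0.
  by rewrite scalerBl -fE scale1r subrr.
move/eqP; rewrite scaler_eq0 (negPf f0) orbF subr_eq0 => /eqP E.
exact: divr1_eq (esym E).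
Qed.

Lemma cvg_speed (T : Type) (F : set_system T) {FF : Filter F} t
    (y : T -> state) : W (xs t) -> y u @[u --> F] --> xs t ->
  speed (y u) @[u --> F] --> speed (xs t).
Proof.
move=> Wx yx; apply: cvg_derive => //.
- have : nbhs (xs t) W by exact: open_nbhs_nbhs.
  by apply: filterS => x /C1b[].
- by move=> w; have [_] := C1b Wx; apply.
- exact: (@continuous_cvg _ _ _ _ _ _ f _ (@cf t) yx).
Qed.

End Branch.

(** * Outputs with a closed equation along the flow, read in the chart *)

Variables (H : 'I_2 -> state -> R) (N : 'I_2 -> R -> R -> R).
Hypothesis dH : forall i x, differentiable (H i) x.
Hypothesis cH : forall i w x, {for x, continuous (fun x => 'D_w (H i) x)}.
Hypothesis flowH : forall i x, U x -> 'D_(f x) (H i) x = N i (H 0 x) (H 1 x).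
Hypothesis Hxs : forall i t, H i (xs t) = 0.
Hypothesis homN : forall i c a b, N i (c * a) (c * b) = c * N i a b.
Hypothesis cvgN2 : forall i (T : Type) (F : set_system T) (FF : Filter F)
  (a b : T -> R) a0 b0, a u @[u --> F] --> a0 -> b u @[u --> F] --> b0 ->
  N i (a u) (b u) @[u --> F] --> N i a0 b0.

Definition chart_output i := H i \o Phi.

Lemma differentiable_chart_output i s z :
  V (s, z) -> differentiable (chart_output i) (s, z).
Proof.
move=> Vsz; apply: differentiable_comp; first exact: differentiable_Phi.
exact: dH.
Qed.

Lemma derive_chart_output i s z v : V (s, z) ->
  'D_v (chart_output i) (s, z) = 'D_('D_v Phi (s, z)) (H i) (Phi (s, z)).
Proof.
move=> Vsz; apply: derive_compE; first exact: differentiable_Phi.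
exact: dH.
Qed.

Lemma cvg_derive_chart_output (T : Type) (F : set_system T) {FF : Filter F}
    i t (g : T -> R * 'cV[R]_3) w : g u @[u --> F] --> (taus t, 0 : 'cV[R]_3) ->
  'D_w (chart_output i) (g u) @[u --> F] --> 'D_w (chart_output i) (taus t, 0).
Proof.
move=> gt; rewrite derive_chart_output//.
have Vg : \forall u \near F, V (g u).
  by apply: gt; apply: open_nbhs_nbhs; split.
have E : \forall u \near F, 'D_('D_w Phi (g u)) (H i) (Phi (g u)) =
    'D_w (chart_output i) (g u).
  by apply: filterS Vg => u; case: (g u) => s z Vsz; rewrite derive_chart_output.
apply: cvg_trans (near_eq_cvg E) _.
have [dPhi cPhi] := C1Phi (Vtaus t).
have nH : \forall x \near Phi (taus t, 0), differentiable (H i) x.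
  exact: (@filterE _ (nbhs (Phi (taus t, 0))) _ _ (dH i)).
apply: (cvg_derive nH).
- by move=> v; exact: cH.
- apply: (@continuous_cvg _ _ _ _ _ _ Phi _ _ gt).
  exact: differentiable_continuous.
- exact: (@continuous_cvg _ _ _ _ _ _ (fun y => 'D_w Phi y) _ (cPhi w) gt).
Qed.

Lemma derive_chart_output_sum i s z v : V (s, z) ->
  'D_((0, v) : R * 'cV[R]_3) (chart_output i) (s, z) =
  \sum_j v j 0 * 'D_((0, delta_mx j 0) : R * 'cV[R]_3) (chart_output i) (s, z).
Proof.
move=> Vsz; have dK := differentiable_chart_output i Vsz.
have -> : ((0, v) : R * 'cV[R]_3) =
    \sum_j v j 0 *: ((0, delta_mx j 0) : R * 'cV[R]_3).
  apply: injective_projections => /=.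
    rewrite (big_morph fst (fun _ _ => erefl) erefl) big1//= => j _.
    exact: mulr0.
  rewrite (big_morph snd (fun _ _ => erefl) erefl)/=; exact: cV_sum_delta.
by rewrite derive_sumv//; apply: eq_bigr => j _; rewrite deriveZv.
Qed.

Lemma euclid_normZ n (d : R) (v : 'cV[R]_n) :
  euclid_norm (d *: v) = `|d| * euclid_norm v.
Proof.
rewrite /euclid_norm -sqrtr_sqr -sqrtrM ?sqr_ge0//; congr Num.sqrt.
by rewrite mulr_sumr; apply: eq_bigr => j _; rewrite mxE exprMn.
Qed.

Lemma le_euclid_norm n (v : 'cV[R]_n) j : `|v j 0| <= euclid_norm v.
Proof.
rewrite -sqrtr_sqr /euclid_norm ler_wsqrtr// (bigD1 j)//= lerDl.
by apply: sumr_ge0 => k _; exact: sqr_ge0.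
Qed.

Lemma cvg_euclid_norm (T : Type) (F : set_system T) {FF : Filter F} n
    (v : T -> 'cV[R]_n) (v0 : 'cV[R]_n) :
  v u @[u --> F] --> v0 -> euclid_norm (v u) @[u --> F] --> euclid_norm v0.
Proof.
move=> vv0; apply: (@continuous_cvg _ _ _ F _ _ Num.sqrt _ (@sqrt_continuous R _)).
by apply: cvg_sumr => i; apply: cvgM; apply: cvg_coord; exact: vv0.
Qed.

(** * Outputs along a solution of the transverse linearization *)

Section Linearization.
Variable zeta : R -> 'cV[R]_3.
Hypothesis dzeta : forall s : R, is_derive s 1 zeta (A s *m zeta s).

Let zt t := zeta (taus t).
(** In the notation W for the transverse differential, this is row i of W(taus t) applied to the
    solution [zeta] at time [taus t]. *)
Definition linear_output i t := 'D_((0, zt t) : R * 'cV[R]_3) (chart_output i) (taus t, 0).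

Let kap i t d := 'D_((0, zt t) : R * 'cV[R]_3) (chart_output i) (taus t, d *: zt t).
Let phi i t d := chart_output i (taus t, d *: zt t).
Let gam (p : R * R) : R * 'cV[R]_3 := (taus p.1, p.2 *: zt p.1).

Let ctaus t : {for t, continuous taus}.
Proof. by apply: differentiable_continuous; apply/derivable1_diffP. Qed.

Let czt t : {for t, continuous zt}.
Proof.
apply: continuous_comp; first exact: ctaus.
apply: differentiable_continuous; apply/derivable1_diffP.
by case: (dzeta (taus t)).
Qed.

Let czt1 (t : R) : zt p.1 @[p --> (t, 0 : R)] --> zt t.
Proof. by apply: (@continuous_cvg _ _ _ _ _ _ zt _ (@czt t)); exact: cvg_fst. Qed.

Let cvg_gam (t : R) : gam p @[p --> (t, 0 : R)] --> (taus t, 0 : 'cV[R]_3).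
Proof.
have c1 : taus p.1 @[p --> (t, 0 : R)] --> taus t.
  by apply: (@continuous_cvg _ _ _ _ _ _ taus _ (@ctaus t)); exact: cvg_fst.
have c2 : p.2 *: zt p.1 @[p --> (t, 0 : R)] --> (0 : 'cV[R]_3).
  rewrite -[X in _ --> X](scale0r (zt t)).
  by apply: cvgZ; [exact: cvg_snd|exact: czt1].
by have := cvg_pair c1 c2; exact.
Qed.

Let near_V (t : R) : \forall p \near (t, 0 : R), V (gam p).
Proof. by apply: cvg_gam; apply: open_nbhs_nbhs; split. Qed.

Let cvg_Phi_gam (t : R) : Phi (gam p) @[p --> (t, 0 : R)] --> xs t.
Proof.
rewrite -Phi_taus; apply: (@continuous_cvg _ _ _ _ _ _ Phi _ _ (@cvg_gam t)).
by apply: differentiable_continuous; exact: differentiable_Phi.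
Qed.

Let cvg_kap i (t : R) : kap i p.1 p.2 @[p --> (t, 0 : R)] --> linear_output i t.
Proof.
have E : \forall p \near (t, 0 : R),
    \sum_j zt p.1 j 0 *
      'D_((0, delta_mx j 0) : R * 'cV[R]_3) (chart_output i) (gam p) =
    kap i p.1 p.2.
  by apply: filterS (near_V t) => p Vp; rewrite /kap derive_chart_output_sum.
apply: cvg_trans (near_eq_cvg E) _.
rewrite /linear_output derive_chart_output_sum//.
apply: cvg_sumr => j; apply: cvgM; first by apply: cvg_coord; exact: czt1.
by apply: cvg_derive_chart_output; exact: cvg_gam.
Qed.

Let phi_derive_d i (t d : R) : V (taus t, d *: zt t) ->
  is_derive d 1 (phi i t) (kap i t d).
Proof.
move=> Vd.
have dZ : differentiable (fun d : R => d *: zt t : 'cV[R]_3) d.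
  by apply: (@differentiableZl _ _ _ id).
have dp : differentiable (fun d : R => (taus t, d *: zt t)) d.
  exact: differentiable_pair.
apply: (is_derive_comp dp); first exact: differentiable_chart_output.
rewrite (derive_pairE _ _ dZ)// derive_cst; congr pair.
rewrite (deriveE _ dZ) (@diffZl _ _ _ id)//.
by rewrite -deriveE// derive_id scale1r.
Qed.

(** The velocity of the displaced curve is a multiple of (1, A z) with z = d zeta, and so differs
    from the flow direction (1, A z + r) only by the remainder. *)
Let phi_derive_t i (t d : R) : V (taus t, d *: zt t) ->
  is_derive t 1 (fun t => phi i t d)
    ('D_1 taus t * 'D_((1, A (taus t) *m (d *: zt t)) : R * 'cV[R]_3)
       (chart_output i) (taus t, d *: zt t)).
Proof.
move=> Vd.
have dta : differentiable taus t by apply/derivable1_diffP.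
have dze : differentiable zeta (taus t).
  by apply/derivable1_diffP; case: (dzeta (taus t)).
have dzt : differentiable zt t by exact: differentiable_comp.
have dZ : differentiable (fun t : R => d *: zt t : 'cV[R]_3) t.
  exact: differentiableZ.
have dp : differentiable (fun t : R => (taus t, d *: zt t)) t.
  exact: differentiable_pair.
have dK := differentiable_chart_output i Vd.
rewrite -[_ * _](deriveZv _ _ dK).
apply: (is_derive_comp dp dK).
rewrite (derive_pairE _ dta dZ).
rewrite [RHS]surjective_pairing/=; congr pair; first by rewrite [RHS]mulr1.
rewrite deriveZ; last exact: diff_derivable.
rewrite (@derive_compE R R R _ taus zeta t 1 dta dze).
have -> : 'D_('D_1 taus t) zeta (taus t) = 'D_1 taus t *: (A (taus t) *m zt t).
  have := @deriveZv R R _ zeta (taus t) ('D_1 taus t) 1 dze; rewrite [_ *: 1]mulr1 => ->.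
  by case: (dzeta (taus t)) => _ ->.
by rewrite -scalemxAr !scalerA mulrC.
Qed.

(** The curve displaced by d zeta follows the flow up to a remainder of order d^2 and a change of
    clock taus' / speed. After division by d the remainder is of order d, and the clock ratio tends
    to 1 on the orbit. *)
Lemma linear_output_derive i (t : R) :
  is_derive t 1 (linear_output i) (N i (linear_output 0 t) (linear_output 1 t)).
Proof.
have [b [W [oW Wxs C1b Wb]]] := branchU (Uxs t).
pose x p := Phi (gam p).
pose rho p := r (tau (x p)) (p.2 *: zt p.1).
(* The t-derivative of [phi] divided by d: (1, A z) is written as (1, A z + r) - (0, r), and
   homogeneity of [N] moves the factor 1 / d into its arguments. *)
pose dphi i p := 'D_1 taus p.1 *
  ((speed b (x p))^-1 * N i (phi 0 p.1 p.2 / p.2) (phi 1 p.1 p.2 / p.2)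
   - \sum_j (rho p j 0 / p.2) *
      'D_((0, delta_mx j 0) : R * 'cV[R]_3) (chart_output i) (gam p)).
have phi0 j u : phi j u 0 = 0 by rewrite /phi scale0r /chart_output /= Phi_taus Hxs.
have nearW0 : nbhs (xs t) W by exact: open_nbhs_nbhs.
have Wx : \forall p \near (t, 0 : R), W (x p) by exact: (@cvg_Phi_gam t).
have quot j : phi j p.1 p.2 / p.2 @[p --> punctured t] --> linear_output j t.
  have -> : linear_output j t = kap j t 0 by rewrite /kap scale0r.
  apply: cvg_quotient; last by rewrite {2}/kap scale0r; exact: cvg_kap.
  apply: filterS (near_V t) => p Vp; split; first exact: phi0.
  exact: phi_derive_d.
have -> : linear_output i = (fun t => kap i t 0).
  by apply/funext => u; rewrite /kap scale0r.
apply: (@is_derive_interchange _ (phi i) (kap i) (fun t d => dphi i (t, d))).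
- have phid u : phi i u 0 = 0 /\ is_derive (0 : R) 1 (phi i u) (kap i u 0).
    by split; [exact: phi0|apply: phi_derive_d; rewrite scale0r].
  exact: (@filterE _ (nbhs t) _ _ phid).
- have VW : \forall p \near (t, 0 : R), V (gam p) /\ W (x p).
    by apply: filterI; [exact: near_V|exact: Wx].
  apply: (near_punctured VW) => -[u d] /= d0 [/= Vp Wp].
  apply: is_derive_eq (phi_derive_t i Vp) _.
  have dK := differentiable_chart_output i Vp.
  have := derive_Phi_flow oW C1b Wb Vp Wp.
  move=> /(congr1 (fun v => 'D_v (H i) (Phi (taus u, d *: zt u)))).
  rewrite -(derive_chart_output i _ Vp) (deriveZv _ _ (dH i _)).
  have [Up _ _] := UPhi Vp; rewrite (flowH i Up).
  have -> : ((1, A (taus u) *m (d *: zt u) + r (tau (Phi (taus u, d *: zt u))) (d *: zt u))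
      : R * 'cV[R]_3) = (1, A (taus u) *m (d *: zt u)) + (0, rho (u, d)).
    by apply: injective_projections => //=; rewrite addr0.
  rewrite (deriveDv _ _ dK) => /eqP; rewrite eq_sym -subr_eq => /eqP <-.
  rewrite derive_chart_output_sum// /dphi/= -/(gam (u, d)) mulrCA; congr (_ * _).
  rewrite mulrBr mulr_sumr; congr (_ - _).
    rewrite mulrCA -homN; congr (_ * _).
    by rewrite !mulrA ![d * _]mulrC !mulfK.
  by apply: eq_bigr => j _; rewrite mulrA [d * _]mulrC divfK.
- have pw (g : R * R -> R) (l : R) : g p @[p --> (t, 0 : R)] --> l ->
      g p @[p --> punctured t] --> l by exact: cvg_within_filter.
  have sp0 := speed_neq0 oW C1b Wb (Uxs t) Wxs.
  have cxs1 : xs p.1 @[p --> (t, 0 : R)] --> xs t.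
    apply: (@continuous_cvg _ _ _ _ _ _ xs); last exact: cvg_fst.
    by apply: differentiable_continuous; apply/derivable1_diffP; case: (dxs t).
  (* Continuity of taus' is not assumed; near t it coincides with the speed along the orbit, which
     is continuous. *)
  have ctaus' : 'D_1 taus p.1 @[p --> punctured t] --> speed b (xs t).
    apply: pw; have E : \forall p \near (t, 0 : R),
        speed b (xs p.1) = 'D_1 taus p.1.
      have Wx1 : \forall p \near (t, 0 : R), W (xs p.1) by exact: (cxs1 _ nearW0).
      by apply: filterS Wx1 => p Wp; rewrite (derive_taus oW C1b Wb).
    apply: cvg_trans (near_eq_cvg E) _.
    exact: (cvg_speed oW C1b Wxs cxs1).
  have cspeed : (speed b (x p))^-1 @[p --> punctured t] --> (speed b (xs t))^-1.
    apply: pw; apply: cvgV => //.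
    exact: (cvg_speed oW C1b Wxs (@cvg_Phi_gam t)).
  (* From |r| <= K |d zeta|^2, the quotient r / d is at most |K| |d| |zeta|^2. The absolute value of
     K is taken because its sign is unknown. *)
  have crho j : rho p j 0 / p.2 @[p --> punctured t] --> (0 : R).
    have [K [delta [delta0 Kr]]] := ho.
    pose en (p : R * R) := euclid_norm (zt p.1).
    have cen : en p @[p --> (t, 0 : R)] --> euclid_norm (zt t).
      by apply: cvg_euclid_norm; exact: czt1.
    have cn2 : `|p.2| @[p --> (t, 0 : R)] --> (0 : R).
      by rewrite -[X in _ --> X](@normr0 R R); apply: cvg_norm; exact: cvg_snd.
    have csmall : `|p.2| * en p @[p --> (t, 0 : R)] --> (0 : R).
      by rewrite -[X in _ --> X](mul0r (euclid_norm (zt t))); apply: cvgM.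
    have cbound : `|K| * (`|p.2| * en p * en p) @[p --> punctured t] --> (0 : R).
      apply: pw; rewrite -[X in _ --> X](mulr0 `|K|); apply: cvgM; first exact: cvg_cst.
      by rewrite -[X in _ --> X](mul0r (euclid_norm (zt t))); apply: cvgM.
    have small : \forall p \near (t, 0 : R), `|p.2| * en p < delta.
      exact: (cvgr_lt _ csmall).
    have bound : \forall p \near punctured t,
        `|rho p j 0 / p.2| <= `|K| * (`|p.2| * en p * en p).
      have Vsm : \forall p \near (t, 0 : R), V (gam p) /\ `|p.2| * en p < delta.
        by apply: filterI; [exact: near_V|exact: small].
      apply: (near_punctured Vsm) => -[u d] /= d0 [/= Vp sm].
      have [Up _ xip] := UPhi Vp.
      have := Kr _ Up; rewrite xip euclid_normZ => /(_ sm) rle.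
      rewrite normrM normfV ler_pdivrMr ?normr_gt0//.
      apply: le_trans (le_euclid_norm _ _) _; apply: le_trans rle _.
      have -> : `|K| * (`|d| * en (u, d) * en (u, d)) * `|d| =
        `|K| * (`|d| * euclid_norm (zt u)) ^+ 2 by rewrite /en/=; ring.
      by rewrite ler_wpM2r ?sqr_ge0// ler_norm.
    apply/cvgrPdist_le => e e0; move/cvgrPdist_le : cbound => /(_ e e0) cb.
    apply: filterS (filterI bound cb) => p [b1 b2].
    rewrite sub0r normrN; apply: le_trans b1 _; apply: le_trans b2.
    by rewrite sub0r normrN ler_norm.
  have cK j : 'D_((0, delta_mx j 0) : R * 'cV[R]_3) (chart_output i) (gam p)
      @[p --> punctured t] -->
      'D_((0, delta_mx j 0) : R * 'cV[R]_3) (chart_output i) (taus t, 0).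
    by apply: pw; apply: cvg_derive_chart_output; exact: cvg_gam.
  have csum : \sum_j (rho p j 0 / p.2) *
      'D_((0, delta_mx j 0) : R * 'cV[R]_3) (chart_output i) (gam p)
      @[p --> punctured t] --> (0 : R).
    have sum0 : \sum_(j < 3) 0 *
        'D_((0, delta_mx j 0) : R * 'cV[R]_3) (chart_output i) (taus t, 0) = 0.
      by rewrite big1// => j _; rewrite mul0r.
    rewrite -[X in _ --> X]sum0.
    by apply: cvg_sumr => j; apply: cvgM; [exact: crho|exact: cK].
  have cN := @cvgN2 i _ _ (punctured_filter t) _ _ _ _ (quot 0) (quot 1).
  set L := N i (linear_output 0 t) (linear_output 1 t).
  have -> : L = speed b (xs t) * ((speed b (xs t))^-1 * L - 0).
    by rewrite subr0 mulrA divff// mul1r.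
  apply: cvgM; first exact: ctaus'.
  by apply: cvgB; [apply: cvgM; [exact: cspeed|exact: cN]|exact: csum].
Qed.

End Linearization.

(** * The output matrix: equation, monodromy relation, rank *)

Section OutputMatrix.
Variable X : R -> 'M[R]_3.
Hypotheses (cA : continuous A) (XA : principal_fundamental A X).
Variable T : R.
Hypothesis tausT : taus T = taus 0 + P.
Hypothesis submersion : forall y : 'I_2 -> R,
  exists w, forall i, 'D_w (H i) (xs 0) = y i.

(** The matrix Y(t) = W(taus t) X(taus t), given by columns so that each is the output of one
    solution of the linear system. *)
Definition output_matrix t : 'M[R]_(2, 3) := \matrix_(i, j)
  'D_((0, X (taus t) *m delta_mx j 0) : R * 'cV[R]_3) (chart_output i) (taus t, 0).

Lemma output_matrix_mul t (c : 'cV[R]_3) i : (output_matrix t *m c) i 0 =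
  'D_((0, X (taus t) *m c) : R * 'cV[R]_3) (chart_output i) (taus t, 0).
Proof.
have dK := differentiable_chart_output i (Vtaus t).
rewrite mxE.
have -> : ((0, X (taus t) *m c) : R * 'cV[R]_3) =
    \sum_j c j 0 *: ((0, X (taus t) *m delta_mx j 0) : R * 'cV[R]_3).
  apply: injective_projections => /=.
    rewrite (big_morph fst (fun _ _ => erefl) erefl) big1//= => j _.
    exact: mulr0.
  rewrite (big_morph snd (fun _ _ => erefl) erefl)/= {1}(cV_sum_delta c).
  by rewrite mulmx_sumr; apply: eq_bigr => j _; rewrite scalemxAr.
rewrite derive_sumv//; apply: eq_bigr => j _.
by rewrite deriveZv// mxE mulrC.
Qed.

Lemma output_matrix_derive (t : R) i j : is_derive t 1
  (fun t => output_matrix t i j)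
  (N i (output_matrix t 0 j) (output_matrix t 1 j)).
Proof.
pose zeta s := X s *m (delta_mx j 0 : 'cV[R]_3).
have YE k : (fun t => output_matrix t k j) = linear_output zeta k.
  by apply/funext => u; rewrite mxE.
rewrite YE -[output_matrix t 0 j]/((fun t => output_matrix t 0 j) t) YE.
rewrite -[output_matrix t 1 j]/((fun t => output_matrix t 1 j) t) YE.
apply: linear_output_derive => s; exact: fundamental_solution.
Qed.

(** [Phi] is P-periodic in s, so the chart outputs and their derivatives are too. *)
Lemma derive_chart_output_periodic i s w : V (s, 0) ->
  'D_w (chart_output i) (s + P, 0) = 'D_w (chart_output i) (s, 0).
Proof.
move=> Vs; pose c : R * 'cV[R]_3 := (P, 0).
have sc : (s, 0) + c = (s + P, 0) :> R * 'cV[R]_3.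
  by apply: injective_projections => //=; rewrite addr0.
have VsP : V (s + P, 0) by have [] := Phi_periodic 1 Vs.
have dsh : differentiable (id + cst c) (s, 0 : 'cV[R]_3).
  by apply: differentiableD.
have shE : 'D_w (id + cst c) (s, 0 : 'cV[R]_3) = w.
  rewrite deriveD; [|exact: diff_derivable|exact: diff_derivable].
  by rewrite derive_id derive_cst addr0.
have per : \forall y \near (s, 0 : 'cV[R]_3),
    (chart_output i \o (id + cst c)) y = chart_output i y.
  have : nbhs (s, 0 : 'cV[R]_3) V by exact: open_nbhs_nbhs.
  apply: filterS => -[u z] Vu; rewrite /chart_output /=.
  have [_] := Phi_periodic 1 Vu; rewrite mulr1z => <-.
  by congr (H i (Phi _)); apply: injective_projections => //=; rewrite addr0.
have shs : (id + cst c) (s, 0 : 'cV[R]_3) = (s + P, 0) by exact: sc.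
have dKs : differentiable (chart_output i) ((id + cst c) (s, 0 : 'cV[R]_3)).
  by rewrite shs; exact: differentiable_chart_output.
by rewrite -(near_eq_derive w per) (derive_compE w dsh dKs) shE shs.
Qed.

Lemma output_matrix_monodromy : output_matrix T = output_matrix 0 *m X P.
Proof.
apply/matrixP => i j; rewrite mxE tausT derive_chart_output_periodic//.
rewrite (fundamental_monodromy cA pA XA) -mulmxA -output_matrix_mul.
by rewrite mulmxA -colE mxE.
Qed.

(** The differential of H is onto and kills the flow direction, so it is still onto when restricted
    to the transverse directions; X is invertible. *)
Lemma rank_output_matrix : \rank (output_matrix 0) = 2%N.
Proof.
have [b [W [oW Wxs C1b Wb]]] := branchU (Uxs 0).
(* On the orbit (1, 0) is the flow direction, along which the derivative of H is proportional to
   N(0, 0) = 0, by homogeneity with factor 0. *)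
have K10 i : 'D_((1, 0) : R * 'cV[R]_3) (chart_output i) (taus 0, 0) = 0.
  rewrite derive_chart_output//.
  have := derive_Phi_flow oW C1b Wb (Vtaus 0); rewrite Phi_taus => /(_ Wxs)/=.
  rewrite remainder_xs mulmx0 addr0 => ->.
  rewrite deriveZv// flowH; last exact: Uxs.
  have N0 : N i 0 0 = 0 by have := homN i 0 0 0; rewrite !mul0r.
  by rewrite !Hxs N0 scaler0.
have surj (y : 'I_2 -> R) : exists c : 'cV[R]_3,
    forall i, (output_matrix 0 *m c) i 0 = y i.
  have [w wy] := submersion y.
  (* The transverse component of [w], pulled back by X; its tau-component contributes nothing. *)
  exists (invmx (X (taus 0)) *m 'D_w xi (xs 0)) => i.
  rewrite output_matrix_mul mulKVmx ?(fundamental_unit cA XA)//.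
  have dK := differentiable_chart_output i (Vtaus 0).
  have lift := derive_Phi_lift oW C1b Wb w (Vtaus 0).
  rewrite Phi_taus in lift; have {}lift := lift Wxs; rewrite /= in lift.
  have HE : 'D_w (H i) (xs 0) = 'D_(('D_w b (xs 0), 'D_w xi (xs 0)))
      (chart_output i) (taus 0, 0).
    by rewrite (derive_chart_output i _ (Vtaus 0)) lift Phi_taus.
  rewrite -(wy i) HE.
  have -> : ('D_w b (xs 0), 'D_w xi (xs 0)) =
      'D_w b (xs 0) *: ((1, 0) : R * 'cV[R]_3) + (0, 'D_w xi (xs 0)).
    apply: injective_projections => /=; last by rewrite scaler0 add0r.
    by rewrite addr0 [RHS]mulr1.
  by rewrite (deriveDv _ _ dK) (deriveZv _ _ dK) K10 scaler0 add0r.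
have [c0 c0E] := surj (fun i => (i == 0)%:R).
have [c1 c1E] := surj (fun i => (i == 1)%:R).
apply/eqP; apply/row_freeP.
exists (\matrix_(i, j) (if j == 0 then c0 i 0 else c1 i 0)).
apply/matrixP => i j; have [j0|j0] := eqVneq j 0.
  rewrite j0 [RHS]mxE -c0E !mxE; apply: eq_bigr => k _.
  by rewrite !mxE.
have -> : j = 1 by case: j j0 => -[|[|//]] ? ?; exact: val_inj.
rewrite [RHS]mxE -c1E !mxE; apply: eq_bigr => k _.
by rewrite !mxE.
Qed.

End OutputMatrix.

End TransverseOutputs.

(** * Proof of the proposition *)

Section Tube.
Variable R : realType.
Local Notation state := ('cV[R]_2 * 'cV[R]_2)%type.

Lemma euclid_norm_ge0 n (v : 'cV[R]_n) : 0 <= euclid_norm v.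
Proof. exact: sqrtr_ge0. Qed.

Lemma euclid_dist_lbound (S : set state) x :
  has_lbound [set euclid_dist x y | y in S].
Proof. by exists 0 => _ [y _ <-]; exact: euclid_norm_ge0. Qed.

Lemma mem_tube (S : set state) eps x : 0 < eps -> S x -> tube S eps x.
Proof.
move=> eps0 Sx; rewrite /tube/= /dist_to; apply: le_lt_trans eps0.
apply: ge_inf; first exact: euclid_dist_lbound.
exists x => //; rewrite /euclid_dist !subrr /euclid_norm big1 ?sqrtr0// => i _.
by rewrite col_mx0 mxE expr0n.
Qed.

Lemma cvg_euclid_dist (x y : state) :
  euclid_dist u y @[u --> x] --> euclid_dist x y.
Proof.
apply: cvg_euclid_norm; apply: cvg_mxP => i j.
have c1 : u.1 @[u --> x] --> x.1 by exact: cvg_fst.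
have c2 : u.2 @[u --> x] --> x.2 by exact: cvg_snd.
rewrite mxE; under eq_cvg do rewrite mxE.
case: (fintype.split i) => k; apply: cvg_coord.
  by apply: cvgB; [exact: c1|exact: cvg_cst].
by apply: cvgB; [exact: c2|exact: cvg_cst].
Qed.

(** Some point y of S is already closer than [eps] to x, and this persists for nearby points. S has
    to be nonempty for the infimum to be approached by actual distances. *)
Lemma open_tube (S : set state) eps : S !=set0 -> open (tube S eps).
Proof.
move=> [y0 Sy0]; rewrite openE => x xeps; rewrite /interior.
have S0 : [set euclid_dist x y | y in S] !=set0 by exists (euclid_dist x y0), y0.
have [_ [y Sy <-] xy] := inf_lt S0 xeps.
have near_lt : \forall u \near x, euclid_dist u y < eps.
  exact: (cvgr_lt _ (@cvg_euclid_dist x y)).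
apply: filterS near_lt => u uy; rewrite /tube/= /dist_to.
by apply: le_lt_trans uy; apply: ge_inf; [exact: euclid_dist_lbound|exists y].
Qed.

End Tube.

Theorem proposition2 (R : realType)
  (M : 'cV[R]_2 -> 'M[R]_2) (C : 'cV[R]_2 -> 'cV[R]_2 -> 'M[R]_2)
  (G F : 'cV[R]_2 -> 'cV[R]_2) (h : 'cV[R]_2 -> R)
  (qs : R -> 'cV[R]_2) (T nu1 nu2 eps : R)
  (tau : 'cV[R]_2 * 'cV[R]_2 -> R) (xi : 'cV[R]_2 * 'cV[R]_2 -> 'cV[R]_3)
  (taus : R -> R) (Ttau : R)
  (A : R -> 'M[R]_3) (r : R -> 'cV[R]_3 -> 'cV[R]_3) (X : R -> 'M[R]_3)
  (f := closed_loop M C G F h nu1 nu2)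
  (U := tube (range (phase qs)) eps) :
  mechanical_system M C G F ->
  C2 h ->
  0 < T -> 0 < nu1 -> 0 < nu2 -> 0 < eps -> 0 < Ttau ->
  (exists u, mechanical_trajectory M C G F u qs) ->
  (forall t, phase qs (t + T) = phase qs t) ->
  (exists t1 t2, phase qs t1 <> phase qs t2) ->
  (forall t, h (qs t) = 0) ->
  (exists O : set 'cV[R]_2, [/\ open O, forall t, O (qs t)
     & forall q, O q -> actuation_regular M F h q]) ->
  (forall x, U x -> actuation_regular M F h x.1) ->
  (forall t : R, is_derive t 1 (phase qs) (f (phase qs t))) ->
  transverse_coordinates T Ttau (phase qs) U tau xi taus ->
  continuous A -> periodic A Ttau ->
  higher_order U tau xi r ->
  transverse_dynamics Ttau U f tau xi A r ->
  principal_fundamental A X ->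
  diagonalizable (complexify (X Ttau)) ->
  exists (mu1 mu2 : R[i]) (e1 e2 : R -> 'cV[R[i]]_3),
    [/\ `|mu1| < 1, `|mu2| < 1
      & ('X - mu1%:P) * ('X - mu2%:P) %| char_poly (complexify (X Ttau))] /\
    [/\ floquet_solution A Ttau mu1 e1, floquet_solution A Ttau mu2 e2,
        lin_indep e1 e2
      & real_floquet_pair mu1 mu2 e1 e2 \/ conj_floquet_pair mu1 mu2 e1 e2] /\
    [/\ forall s, \dim (floquet_span e1 e2 s) = 2%N
      & forall (s0 : R) (z : R -> 'cV[R]_3),
          solution_on [set s | s0 <= s] A z -> z s0 \in floquet_span e1 e2 s0 ->
          (forall s, s0 <= s -> z s \in floquet_span e1 e2 s) /\
          z s @[s --> +oo] --> (0 : 'cV[R]_3)].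
Proof.
move=> sys C2h T0 nu1_gt0 nu2_gt0 eps0 P0 _ xsT _ hqs _ regU dxs
  [xi0 [tausE [c _ dtaus0] _ tausT] [C1xi branchU
  [V [Phi [oV C1Phi PhiK UPhi Phi_periodic]]]]] cA pA ho dyn XA diagX.
pose xs := phase qs.
have Uxs t : U (xs t) by apply: mem_tube => //; exists t.
have oU : open U by apply: open_tube; exists (xs 0), 0.
have xs_periodic t (n : int) : xs (t + T *~ n) = xs t by exact: periodic_int.
(* The coordinates describe [taus] on [0, T) only; whole periods are removed to get there. *)
have reduce t : exists2 n : int, 0 <= t - T *~ n < T & t = (t - T *~ n) + T *~ n.
  exists (Num.floor (t / T)); last by rewrite subrK.
  have /andP[] := floor_itv (t / T).
  rewrite ler_pdivlMr// ltr_pdivrMr// !mulrzl mulrzDr mulr1z => lo hi.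
  by rewrite subr_ge0 lo ltrBlDl.
have orbit t : V (taus t, 0) /\ Phi (taus t, 0) = xs t.
  have [n t0 ->] := reduce t; set t' := t - T *~ n in t0 *.
  have [Vt Phit] := PhiK _ (Uxs t'); rewrite xi0 in Vt Phit.
  have [Vn Phin] := Phi_periodic _ _ n Vt.
  by rewrite tausT xs_periodic (tausE _ t0) Phin.
have Vtaus t := (orbit t).1; have Phi_taus t := (orbit t).2.
have dtaus t : derivable taus t 1.
  have [n t0 _] := reduce t; have [dt _] := dtaus0 _ t0.
  (* [taus] equals its translate by whole periods plus a constant, so derivability is inherited from
     [0, T). *)
  have -> : taus = (taus \o shift (- (T *~ n))) + cst (Ttau *~ n).
    apply/funext => u; have := tausT (u - T *~ n) n.
    by rewrite subrK.
  apply: derivableD; last exact: derivable_cst.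
  apply/derivable1_diffP.
  by apply: differentiable_comp => //; apply/derivable1_diffP.
have dHo := differentiable_output C2h.
have Hxs i t : output h i (xs t) = 0.
  have h0 : output h 0 \o xs = cst 0 by apply/funext => u; exact: hqs.
  have [->|i0] := eqVneq i 0; first exact: hqs.
  have -> : i = 1 by case: i i0 => -[|[|//]] ? ?; exact: val_inj.
  (* L_qdot h is the derivative of h along the flow, hence 0 on the orbit, where h is constant. *)
  rewrite -(derive_flow_output0 M C G F nu1 nu2 C2h).
  have [dx dxE] := dxs t; rewrite -/f -dxE.
  rewrite -[LHS](@derive_compE R R _ _ xs (output h 0) t 1) ?h0 ?derive_cst//.
  exact/derivable1_diffP.
pose N (i : 'I_2) (a b : R) := if i == 0 then b else - nu1 * a - nu2 * b.
have flowH i x : U x -> 'D_(f x) (output h i) x = N i (output h 0 x) (output h 1 x).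
  move=> Ux; rewrite /N; have [->|i0] := eqVneq i 0.
    exact: derive_flow_output0.
  have -> : i = 1 by case: i i0 => -[|[|//]] ? ?; exact: val_inj.
  by apply: derive_flow_output1 => //; exact: regU.
have homN i d a b : N i (d * a) (d * b) = d * N i a b.
  by rewrite /N; case: ifP => // _; ring.
have cvgN2 i (S : Type) (FS : set_system S) (FF : Filter FS) (a b : S -> R) a0 b0 :
    a u @[u --> FS] --> a0 -> b u @[u --> FS] --> b0 ->
    N i (a u) (b u) @[u --> FS] --> N i a0 b0.
  move=> aa0 bb0; rewrite /N; case: ifP => // _.
  by apply: cvgB; apply: cvgM => //; exact: cvg_cst.
have cf t : {for xs t, continuous f}.
  by apply: continuous_closed_loop => //; exact: (regU _ (Uxs t)).
have submersion (y : 'I_2 -> R) : exists w, forall i, 'D_w (output h i) (xs 0) = y i.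
  have [g0 _] := regU _ (Uxs 0).
  have [w [w0 w1]] := output_submersion C2h (y 0) (y 1) g0.
  exists w => i; have [->//|i0] := eqVneq i 0.
  by have -> : i = 1 by case: i i0 => -[|[|//]] ? ?; exact: val_inj.
pose Y := output_matrix Phi taus (output h) X.
have dY := output_matrix_derive oU C1xi branchU oV C1Phi PhiK UPhi Phi_periodic
  pA ho dyn Vtaus Phi_taus dtaus dxs cf dHo (continuous_derive_output C2h)
  flowH Hxs homN cvgN2 XA.
have YT : Y T = Y 0 *m X Ttau.
  apply: (output_matrix_monodromy oV C1Phi Phi_periodic pA Vtaus dHo cA XA).
  by have := tausT 0 1; rewrite !mulr1z add0r.
have rY : \rank (Y 0) = 2%N.
  exact: (rank_output_matrix oU C1xi branchU C1Phi PhiK UPhi Phi_periodic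
    pA ho dyn Vtaus Phi_taus dHo flowH Hxs homN cA XA submersion).
have mu_lt1 := multiplier_lt1 nu1_gt0 nu2_gt0 T0
  (fun t j => dY t 0 j) (fun t j => dY t 1 j) YT.
have [mu1 [mu2 [a [b [[m1 m2 dvd ab] cases]]]]] := stable_pair rY diagX mu_lt1.
have [e1 [e2 [fl sp]]] := stable_floquet_pair cA pA P0 XA m1 m2 ab cases.
by exists mu1, mu2, e1, e2.
Qed.
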